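(* Let $X\in\mathcal{CM}(\hat\rho,\rho)$ be a Lévy process defined by the characteristic triple $(a,0,\pi)_{h\equiv x}$, with Laplace exponent $\psi$, and suppose that the measure $\mu$ representing $\pi$ has infinite support. For $n\ge1$ let $\{x_i\}_{1\le i\le n}$ and $\{w_i\}_{1\le i\le n}$ be the nodes and weights of the Gaussian quadrature of order $n$ with respect to the finite measure $|v|^3\mu^*(\mathrm{d}v)$ on $[-1/\hat\rho,1/\rho]$, and let $$\psi_n(z):=az+z^2\sum_{i=1}^n\frac{w_i}{1-zx_i}.$$ Then for any compact set $A\subset\mathbb{C}\setminus\{(-\infty,-\hat\rho]\cup[\rho,\infty)\}$ there exist $c_1=c_1(A)>0$ and $c_2=c_2(A)>0$ such that for all $z\in A$ and all $n\ge1$ $$|\psi_n(z)-\psi(z)|<c_1e^{-c_2n}.$$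
   Context: Lévy processes and triples. For a (real-valued, unkilled) Lévy process $X$, the Laplace exponent is $\psi(z):=\ln\mathbb{E}[e^{zX_1}]$, initially defined for $\mathrm{Re}(z)=0$, and $$\psi(z)=\tfrac{\sigma^2}{2}z^2+az+\int_{\mathbb{R}}\left(e^{zx}-1-zh(x)\right)\Pi(\mathrm{d}x),$$ with $\sigma\ge0$, $a\in\mathbb{R}$, Lévy measure $\Pi$ and cutoff function $h$. Standing assumption: $\Pi(\mathrm{d}x)=\pi(x)\mathrm{d}x$ is absolutely continuous and $\pi(x)$ decreases exponentially fast as $x\to\pm\infty$. The characteristic triple $(a,\sigma^2,\pi)_{h\equiv x}$ means that this formula holds with $h(x)=x$. Completely monotone jumps. $X$ has completely monotone jumps if $\pi(x)$ and $\pi(-x)$ are completely monotone functions of $x\in(0,\infty)$; equivalently there is a positive Radon measure $\mu$ on $\mathbb{R}\setminus\{0\}$ with $$\pi(x)=\mathbf{1}_{\{x>0\}}\int_{(0,\infty)}e^{-ux}\mu(\mathrm{d}u)+\mathbf{1}_{\{x<0\}}\int_{(-\infty,0)}e^{-ux}\mu(\mathrm{d}u).$$ Put $\rho:=\sup\{u\ge0:\mu((0,u))=0\}$ and $\hat\rho:=\sup\{u\ge0:\mu((-u,0))=0\}$ (values in $(0,+\infty]$, positive by the standing assumption; $1/\infty:=0$, and $[\rho,\infty)$, resp. $(-\infty,-\hat\rho]$, is empty if $\rho=\infty$, resp. $\hat\rho=\infty$). $\mathcal{CM}(\hat\rho,\rho)$ is the class of Lévy processes with completely monotone jumps (satisfying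 the standing assumption) with these parameters $\hat\rho,\rho$. For such processes $\psi$ extends analytically to $\mathbb{C}\setminus\{(-\infty,-\hat\rho]\cup[\rho,\infty)\}$, and the extension is also denoted $\psi$. The measure $\mu^*$ is defined by $\mu^*(A)=\mu(\{v\in\mathbb{R}:v^{-1}\in A\})$ for Borel $A\subset\mathbb{R}$; it is carried by $[-1/\hat\rho,1/\rho]$, and $|v|^3\mu^*(\mathrm{d}v)$ is a finite measure. Gaussian quadrature. For a finite positive measure $\nu$ with infinite support on a compact interval, the nodes $\{x_i\}_{1\le i\le n}$ (distinct points of the interval) and weights $\{w_i\}_{1\le i\le n}$ (positive) of the Gaussian quadrature of order $n$ are the unique ones satisfying $\int x^k\nu(\mathrm{d}x)=\sum_{i=1}^nx_i^kw_i$ for $k=0,1,\dots,2n-1$. *)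

(* Defs.v *)
From HB Require Import structures.
From mathcomp Require Import all_boot all_order all_algebra.
From mathcomp Require Export complex.
From mathcomp Require Import all_classical all_reals all_analysis.
From mathcomp Require Import measurable_realfun.

Set Implicit Arguments.
Unset Strict Implicit.
Unset Printing Implicit Defensive.

Import Order.TTheory GRing.Theory Num.Theory numFieldNormedType.Exports.
Local Open Scope classical_set_scope.
Local Open Scope complex_scope.
Local Open Scope ring_scope.

(* [R[i]^o] is [R[i]] seen as a normed module over itself; this is the copy of
   the complex numbers on which MathComp-Analysis puts the usual topology. *)
Notation Cplx R := (R[i]^o).

Section complex_analysis.
Context {R : realType}.

Definition cexp (z : Cplx R) : Cplx R :=
  (expR (complex.Re z) * cos (complex.Im z)) +i*
  (expR (complex.Re z) * sin (complex.Im z)).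

Definition Cintegral d (T : measurableType d) (m : {measure set T -> \bar R})
    (f : T -> Cplx R) : Cplx R :=
  (\int[m]_x complex.Re (f x)) +i* (\int[m]_x complex.Im (f x)).

Definition analytic_on (U : set (Cplx R)) (f : Cplx R -> Cplx R) : Prop :=
  forall z0, U z0 -> exists c : nat -> Cplx R,
    \forall z \near z0,
      series (fun k => c k * (z - z0) ^+ k) @ \oo --> f z.

(* C \ ((-oo, -rhoh] U [rho, +oo)); an infinite parameter removes nothing. *)
Definition cut_plane (rhoh rho : \bar R) : set (Cplx R) :=
  [set z | ~ (complex.Im z = 0 /\
     (((complex.Re z)%:E <= - rhoh)%E \/ (rho <= (complex.Re z)%:E)%E))].

End complex_analysis.

Section levy_processes.
Context {R : realType} d (T : measurableType d) (P : probability T R).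

Definition cadlag (f : R -> R) : Prop :=
  forall t, 0 <= t ->
    f @ t^'+ --> f t /\ (0 < t -> cvg (f @ t^'-)).

(* A process is indexed by all of R, but only times t >= 0 are constrained.
   In [levy_indep] the B i may be the whole line, so the product rule over all
   n increments contains that of every subfamily. *)
Record levy_process (X : R -> {RV P >-> R}) : Prop := LevyProcess {
  levy_start : {ae P, forall w, X 0 w = 0};
  levy_stationary : forall s t : R, 0 <= s -> s <= t ->
    forall B : set R, measurable B ->
      P [set w | B (X t w - X s w)] = P [set w | B (X (t - s) w)];
  levy_indep : forall (n : nat) (t : nat -> R), 0 <= t 0%N ->
    (forall i, t i <= t i.+1) ->
    forall B : nat -> set R, (forall i, measurable (B i)) ->
      P [set w | forall i, (i < n)%N -> B i (X (t i.+1) w - X (t i) w)] =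
      (\prod_(i < n) P [set w | B i (X (t i.+1) w - X (t i) w)%R])%E;
  levy_cadlag : {ae P, forall w, cadlag (fun t => X t w)}
}.

(* psi(z) = ln E[exp(z X_1)] for Re z = 0, the logarithm being the branch that
   is continuous along the imaginary axis and vanishes at 0. *)
Definition laplace_exponent (X : R -> {RV P >-> R}) (psi : Cplx R -> Cplx R)
    : Prop :=
  [/\ psi 0 = 0,
      continuous (fun u : R => psi (0 +i* u) : Cplx R) &
      forall z : Cplx R, complex.Re z = 0 ->
        cexp (psi z) = Cintegral P (fun w => cexp (z * (X 1 w)%:C))].

End levy_processes.

Section levy_khintchine.
Context {R : realType}.
Implicit Types (dens h : R -> R) (psi : Cplx R -> Cplx R).

Definition levy_density dens : Prop :=
  [/\ measurable_fun setT dens, forall x, 0 <= dens x &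
      (\int[lebesgue_measure]_x (Num.min 1 (x ^+ 2) * dens x)%:E < +oo)%E].

(* s2 is the variance sigma^2 and h the cutoff function; dens is the density of
   the Levy measure. *)
Definition levy_khintchine h (a s2 : R) dens (z : Cplx R) : Cplx R :=
  (s2 / 2)%:C * z ^+ 2 + a%:C * z +
  Cintegral (@lebesgue_measure R)
    (fun x => (cexp (z * x%:C) - 1 - z * (h x)%:C) * (dens x)%:C).

Definition characteristic_triple h psi (a s2 : R) dens : Prop :=
  [/\ 0 <= s2, levy_density dens &
      forall z : Cplx R, complex.Re z = 0 ->
        psi z = levy_khintchine h a s2 dens z].

Definition exponential_decay dens : Prop :=
  exists C c M : R, 0 < c /\
    forall x, M <= `|x| -> dens x <= C * expR (- (c * `|x|)).

Definition completely_monotone (f : R -> R) : Prop :=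
  forall (n : nat) (x : R), 0 < x ->
    derivable (derive1n n f) x 1 /\ 0 <= (-1) ^+ n * derive1n n f x.

End levy_khintchine.

Section cm_jumps.
Context {R : realType}.
Implicit Types (mu : {measure set R -> \bar R}).

(* A Radon measure on R \ {0}, extended to R by giving {0} mass 0. *)
Definition radon_off0 mu : Prop :=
  mu [set 0] = 0%E /\
  forall K : set R, compact K -> ~ K 0 -> (mu K < +oo)%E.

Definition represents mu (dens : R -> R) : Prop :=
  (forall x : R, 0 < x ->
    (dens x)%:E = (\int[mu]_(u in `]0%R, +oo[) (expR (- (u * x)))%:E)%E) /\
  (forall x : R, x < 0 ->
    (dens x)%:E = (\int[mu]_(u in `]-oo, 0%R[) (expR (- (u * x)))%:E)%E).

Definition rho_of mu : \bar R :=
  ereal_sup [set u%:E | u in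
    [set u : R | 0 <= u /\ mu `]0, u[%classic = 0%E]].

Definition rhoh_of mu : \bar R :=
  ereal_sup [set u%:E | u in
    [set u : R | 0 <= u /\ mu `](- u), 0[%classic = 0%E]].

(* Levy density and mixing measure of a process of the class CM(rhoh, rho). *)
Record CM_class (rhoh rho : \bar R) (dens : R -> R) mu : Prop := CMClass {
  CM_decay : exponential_decay dens;
  CM_pos : completely_monotone dens;
  CM_neg : completely_monotone (fun x => dens (- x));
  CM_radon : radon_off0 mu;
  CM_represents : represents mu dens;
  CM_rho : rho = rho_of mu;
  CM_rhoh : rhoh = rhoh_of mu
}.

(* Taken in R; the point 0 does not affect whether the support is infinite. *)
Definition measure_support mu : set R :=
  [set x | forall U : set R, open U -> U x -> (0 < mu U)%E].

End cm_jumps.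

Section mu_star.
Context {R : realType}.

Lemma measurable_inv_real :
  measurable_fun setT (GRing.inv : R -> R).
Proof.
have -> : [set: R] = [set 0] `|` ~` [set 0] by rewrite setUv.
apply/measurable_funU; [exact: measurable_set1| |split].
- by apply: measurableC; exact: measurable_set1.
- exact: measurable_fun_set1.
- apply: open_continuous_measurable_fun.
    rewrite (_ : ~` [set 0] = [set x : R | x != 0]); first exact: open_neq.
    by apply/seteqP; split => x /= /eqP.
  by move=> x /set_mem /eqP x0; exact: inv_continuous.
Qed.

Variable mu : {measure set R -> \bar R}.

(* [0^-1 = 0] in MathComp, so {0} is mapped to {0}, where mu has no mass. *)
Definition mu_star : set R -> \bar R :=
  pushforward mu (GRing.inv : R -> R).

Let mu_star0 : mu_star set0 = 0%E.
Proof. by rewrite /mu_star /pushforward preimage_set0 measure0. Qed.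

Let mu_star_ge0 A : (0 <= mu_star A)%E.
Proof. by rewrite /mu_star /pushforward measure_ge0. Qed.

Let mu_star_sigma_additive : semi_sigma_additive mu_star.
Proof.
move=> F mF tF mUF; rewrite /mu_star /pushforward preimage_bigcup.
apply: measure_semi_sigma_additive.
- by move=> n; rewrite -[X in measurable X]setTI; exact: measurable_inv_real.
- apply/trivIsetP => /= i j _ _ ij; rewrite -preimage_setI.
  by move/trivIsetP : tF => /(_ _ _ _ _ ij) ->//; rewrite preimage_set0.
- by rewrite -preimage_bigcup -[X in measurable X]setTI;
    exact: measurable_inv_real.
Qed.

HB.instance Definition _ := isMeasure.Build _ _ _ mu_star
  mu_star0 mu_star_ge0 mu_star_sigma_additive.

(* The measure |v|^3 mu_star(dv). *)
Definition cubic_mu_star : set R -> \bar R :=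
  fun A => (\int[mu_star]_(v in A) (`|v| ^+ 3)%:E)%E.

Let cubic0 : cubic_mu_star set0 = 0%E.
Proof. by rewrite /cubic_mu_star integral_set0. Qed.

Let cubic_ge0 A : (0 <= cubic_mu_star A)%E.
Proof. by apply: integral_ge0 => v _; rewrite lee_fin exprn_ge0. Qed.

Let cubic_sigma_additive : semi_sigma_additive cubic_mu_star.
Proof.
move=> /= F mF tF mUF; rewrite /cubic_mu_star; apply: cvg_toP.
  apply: ereal_nondecreasing_is_cvgn => m n mn.
  apply: lee_sum_nneg_natr => // k _ _.
  by apply: integral_ge0 => v _; rewrite lee_fin exprn_ge0.
rewrite ge0_integral_bigcup//=.
by apply/measurable_EFinP; apply: measurable_funX; exact: normr_measurable.
Qed.

HB.instance Definition _ := isMeasure.Build _ _ _ cubic_mu_star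
  cubic0 cubic_ge0 cubic_sigma_additive.

End mu_star.

Section quadrature.
Context {R : realType}.

Definition gauss_quadrature (nu : {measure set R -> \bar R})
    (I : set R) (n : nat) (x w : 'I_n -> R) : Prop :=
  [/\ injective x, forall i, I (x i), forall i, 0 < w i &
      forall k, (k < 2 * n)%N ->
        (\int[nu]_v (v ^+ k)%:E)%E = (\sum_(i < n) x i ^+ k * w i)%:E].

(* [+oo^-1 = 0] in the extended reals. *)
Definition quadrature_interval (rhoh rho : \bar R) : set R :=
  [set v | (- rhoh^-1 <= v%:E)%E /\ (v%:E <= rho^-1)%E].

Definition psi_approx (a : R) (n : nat) (x w : 'I_n -> R) (z : Cplx R)
    : Cplx R :=
  a%:C * z + z ^+ 2 * \sum_(i < n) (w i)%:C / (1 - z * (x i)%:C).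

End quadrature.

(* Main.v *)
Require Import Defs.
From HB Require Import structures.
From mathcomp Require Import all_boot all_order all_algebra.
From mathcomp Require Import complex.
From mathcomp Require Import all_classical all_reals all_analysis.
From mathcomp Require Import measurable_realfun.
From mathcomp Require Import ring lra.
Set Implicit Arguments.
Unset Strict Implicit.
Unset Printing Implicit Defensive.
Import Order.TTheory GRing.Theory Num.Theory numFieldNormedType.Exports.
Import ComplexField.Normc.
Local Open Scope classical_set_scope.
Local Open Scope complex_scope.
Local Open Scope ring_scope.

(** The idea is that psi is a Cauchy-type transform of the measure whose
    quadrature is taken, and that a quadrature rule of order n integrates such
    a transform as well as polynomials of degree below 2n approximate its
    kernel.

    Write nu for the measure |v|^3 mu^*(dv), [al, be] for the interval
    [-1/rhoh, 1/rho] that carries it, and K_z(v) = 1 / (1 - z v).  Two facts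
    give the theorem.

    (1) psi(z) = a z + z^2 int K_z dnu on the whole cut plane
    (laplace_exponent_continuation).  On the half-line z = i t, t > 0, this is
    a computation: the Levy density is a mixture of exponentials, so Fubini
    (mixture_integral) reduces the real and imaginary parts of the
    Levy-Khintchine integral to the Laplace transforms of 1 - cos(t x) and of
    t x - sin(t x), which have elementary primitives; the substitution
    v = 1/u turns the outcome into integrals against nu.  Both sides are
    analytic on the cut plane: expanding K_z geometrically around z0 and
    integrating term by term gives the power series of the right-hand side
    (kernel_integral_analytic).  As the cut plane is star-shaped around 0, the
    identity principle has to be propagated along segments [0, z] only
    (identity_segment).  That rho and rhoh are positive, hence that 0 lies in
    the cut plane and that [al, be] is bounded, follows from the exponential
    decay of the density.

    (2) For z in a compact subset A of the cut plane, K_z is approximated on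
    [al, be] by polynomials of degree below 2n with an error at most
    C theta^n, where C and theta < 1 depend on A only.  The segment
    S = { 1 - z v : v in [al, be] } avoids 0, so it lies in an open half-plane
    { w : <w, e> > 0 }; hence S lies inside the disc of centre c = T e
    through 0 as soon as T is large.  Expanding 1/w around c, that is
    1/w = sum_(k < N) (c - w)^k / c^(k+1) + ((c - w)/c)^N / w,
    gives the polynomial, with N = 2n (kernel_poly_approx).  The angle
    under which S is seen from 0 depends continuously on z, which makes T
    uniform over A (uniform_centre).

    Since the rule is exact on these polynomials and its weights are positive
    with the same total mass as nu, the quadrature error for K_z is at most
    three times the mass times the approximation error
    (gauss_quadrature_error).  The factor is three and not two because complex
    integrals are bounded here through their real and imaginary parts. *)

(** * The modulus and the topology of the complex plane *)

Section modulus.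
Context {R : realType}.
Implicit Types z w e : Cplx R.

Lemma normrE_normc z : `|z| = (normc z)%:C.
Proof. by []. Qed.

Lemma normcX z n : normc (z ^+ n : Cplx R) = normc z ^+ n.
Proof.
by elim: n => [|n IH]; rewrite ?expr0 ?normc1// !exprS normcM IH.
Qed.

Lemma normc_real (r : R) : normc r%:C = `|r|.
Proof. by rewrite /normc/= expr0n/= addr0 sqrtr_sqr. Qed.

Lemma normc_ge0 z : 0 <= normc z.
Proof. by case: z => a b; exact: sqrtr_ge0. Qed.

Lemma normc_eq0 z : (normc z == 0) = (z == 0).
Proof.
by apply/eqP/eqP => [/eq0_normc//|->]; rewrite normc0.
Qed.

Lemma normc_gt0 z : (0 < normc z) = (z != 0).
Proof. by rewrite lt_def normc_ge0 andbT normc_eq0. Qed.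

Lemma sqr_normc z : normc z ^+ 2 = complex.Re z ^+ 2 + complex.Im z ^+ 2.
Proof. by case: z => a b /=; rewrite sqr_sqrtr// addr_ge0// sqr_ge0. Qed.

Lemma normcD z w : normc (z + w) <= normc z + normc w.
Proof. exact: le_normcD. Qed.

Lemma normcB z w : normc (z - w) <= normc z + normc w.
Proof. by rewrite -(normcN w); exact: le_normcD. Qed.

Lemma Re_le_normc z : `|complex.Re z| <= normc z.
Proof.
case: z => a b /=; rewrite -sqrtr_sqr ler_wsqrtr// lerDl sqr_ge0//.
Qed.

Lemma Im_le_normc z : `|complex.Im z| <= normc z.
Proof.
case: z => a b /=; rewrite -sqrtr_sqr ler_wsqrtr// lerDr sqr_ge0//.
Qed.

Lemma normc_le_ReIm z : normc z <= `|complex.Re z| + `|complex.Im z|.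
Proof.
rewrite -(@ler_pXn2r _ 2)// ?nnegrE ?normc_ge0 ?addr_ge0// sqr_normc.
by rewrite sqrrD !real_normK ?num_real// lerD2r lerDl mulrn_wge0//.
Qed.

(** Neighbourhoods in C are defined by balls whose radius is a complex number,
    positive for the partial order of C; such a number is real. *)
Lemma nbhs_normcP z0 (P : set (Cplx R)) :
  (\forall z \near z0, P z) <->
  exists2 r : R, 0 < r & forall z, normc (z - z0) < r -> P z.
Proof.
split.
  move=> /nbhs_ballP[e/= e0 H]; exists (complex.Re e).
    by move: e0; rewrite ltcE => /andP[].
  move=> z zr; apply: H; rewrite -ball_normE/= distrC normrE_normc.
  by move: e0; rewrite !ltcE /= => /andP[/eqP -> _]; rewrite eqxx.
case=> r r0 H; apply/nbhs_ballP; exists r%:C => /=; first by rewrite ltcR.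
move=> z; rewrite -ball_normE/= distrC normrE_normc ltcR; exact: H.
Qed.

Lemma continuous_normcP (f : Cplx R -> R) (k : R) :
  (forall z w, `|f z - f w| <= k * normc (z - w)) -> continuous f.
Proof.
move=> Hf z0; apply/(@cvgrPdist_lt _ _ _ (nbhs (z0 : Cplx R))
  (nbhs_filter (z0 : Cplx R)) f (f z0)) => e e0.
have k0 : 0 < `|k| + 1 by rewrite ltr_pwDr.
apply/nbhs_normcP; exists (e / (`|k| + 1)); first by rewrite divr_gt0.
move=> z zr; rewrite distrC (le_lt_trans (Hf _ _))//.
rewrite (@le_lt_trans _ _ ((`|k| + 1) * normc (z - z0)))//.
  by rewrite ler_wpM2r ?normc_ge0// (le_trans (ler_norm _))// lerDl.
by rewrite mulrC -ltr_pdivlMr.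
Qed.

Lemma continuous_Re : continuous (@complex.Re R : Cplx R -> R).
Proof.
apply: (@continuous_normcP _ 1) => z w; rewrite mul1r.
apply: le_trans (Re_le_normc _); by case: z w => ? ? [].
Qed.

Lemma continuous_Im : continuous (@complex.Im R : Cplx R -> R).
Proof.
apply: (@continuous_normcP _ 1) => z w; rewrite mul1r.
apply: le_trans (Im_le_normc _); by case: z w => ? ? [].
Qed.

Lemma continuous_normc : continuous (@normc R : Cplx R -> R).
Proof.
apply: (@continuous_normcP _ 1) => z w; rewrite mul1r ler_norml.
have := normcD (z - w) w; have := normcD (w - z) z.
rewrite !subrK -(opprB z w) normcN => *; apply/andP; split; lra.
Qed.

End modulus.

(** The expansion of 1/w around c with its exact remainder.  It is used twice:
    with c - w linear in v and c fixed it produces polynomials in v, and with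
    c = 1 - z0 v it produces the Taylor polynomials in z of 1 / (1 - z v). *)
Lemma geometric_remainder (F : fieldType) (c w : F) N : c != 0 -> w != 0 ->
  w^-1 = \sum_(k < N) (c - w) ^+ k / c ^+ k.+1 + ((c - w) / c) ^+ N / w.
Proof.
move=> c0 w0; elim: N => [|N IH]; first by rewrite big_ord0 add0r expr0 div1r.
rewrite big_ord_recr/= {1}IH -addrA; congr (_ + _).
rewrite !exprS exprMn exprVn.
have : c ^+ N != 0 by rewrite expf_neq0.
by move: (c ^+ N) ((c - w) ^+ N) => u v u0; field; rewrite c0 w0 u0.
Qed.

(** * Separating the origin from a segment of points 1 - z v *)

Section separation.
Context {R : realType}.
Implicit Types z w e p q : Cplx R.

(** The Euclidean inner product of the plane, that is Re (z conj(w)). *)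
Definition dotc z w : R :=
  complex.Re z * complex.Re w + complex.Im z * complex.Im w.

Lemma normc_dotc z : normc z ^+ 2 = dotc z z.
Proof. by rewrite sqr_normc /dotc !expr2. Qed.

Lemma dotcDl z w e : dotc (z + w) e = dotc z e + dotc w e.
Proof. by case: z w e => ? ? [? ?] [? ?]; rewrite /dotc/=; ring. Qed.

Lemma dotcZl (r : R) z e : dotc (r%:C * z) e = r * dotc z e.
Proof. by case: z e => ? ? [? ?]; rewrite /dotc/=; ring. Qed.

Lemma dotcC z w : dotc z w = dotc w z.
Proof. by rewrite /dotc; ring. Qed.

Lemma dotc_le z w : `|dotc z w| <= normc z * normc w.
Proof.
rewrite -(@ler_pXn2r _ 2)// ?nnegrE ?mulr_ge0 ?normc_ge0//.
rewrite exprMn !sqr_normc real_normK ?num_real// /dotc -subr_ge0.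
rewrite [X in 0 <= X](_ : _ = (complex.Re z * complex.Im w -
  complex.Im z * complex.Re w) ^+ 2); last by ring.
exact: sqr_ge0.
Qed.

(** [gap p q] is |p| |q| (1 + cos(angle between p and q)): it vanishes exactly
    when p and q point in opposite directions (or one of them is 0), that is
    when the segment [p, q] meets the origin.  Unlike the distance from the
    origin to the segment it is visibly continuous in p and q. *)
Definition gap p q := normc p * normc q + dotc p q.

Lemma gap_ge0 p q : 0 <= gap p q.
Proof. by rewrite /gap; have := dotc_le p q; rewrite ler_norml => /andP[? ?];
  lra. Qed.

(** |(|q| p + |p| q)|^2 = 2 |p| |q| gap p q. *)
Lemma gap_eq0 p q : gap p q = 0 -> (normc q)%:C * p + (normc p)%:C * q = 0.
Proof.
move=> pq0; apply/eq0_normc/eqP; rewrite -sqrf_eq0 normc_dotc.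
rewrite dotcDl !dotcZl ![dotc _ (_ + _)]dotcC !dotcDl !dotcZl -!normc_dotc.
rewrite (dotcC q p); apply/eqP.
rewrite -[RHS](mulr0 (2 * (normc p * normc q))) -[X in _ = _ * X]pq0.
by rewrite /gap; ring.
Qed.

(** If the gap of the two end points vanishes, then |q| p + |p| q = 0, and
    dividing by |p| + |q| exhibits a convex combination v of al and be with
    1 - z v = 0. *)
Lemma gap_gt0 (al be : R) z : al <= be ->
  (forall v : R, al <= v <= be -> 1 - z * v%:C != 0) ->
  0 < gap (1 - z * al%:C) (1 - z * be%:C).
Proof.
move=> ab zv; rewrite lt_def gap_ge0 andbT; apply/eqP => /gap_eq0.
set p := 1 - z * al%:C; set q := 1 - z * be%:C => pq0.
have p0 : 0 < normc p by rewrite normc_gt0 zv// lexx ab.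
have q0 : 0 < normc q by rewrite normc_gt0 zv// lexx ab.
pose v := (normc q * al + normc p * be) / (normc p + normc q).
have s0 : 0 < normc p + normc q by rewrite addr_gt0.
have /zv/eqP[] : al <= v <= be.
  by rewrite /v ler_pdivlMr// ler_pdivrMr//; apply/andP; split; nra.
apply: (@mulfI _ (normc p + normc q)%:C).
  by rewrite -[0]/(0%:C) (inj_eq (@complexI _)) gt_eqF.
have E : (normc p + normc q) * v = normc q * al + normc p * be.
  by rewrite /v mulrC divfK// gt_eqF.
rewrite mulr0 -[RHS]pq0 mulrBr mulr1 mulrCA -rmorphM /= E.
rewrite !rmorphD !rmorphM/=.
set np := (normc p)%:C; set nq := (normc q)%:C.
by rewrite /p /q; ring.
Qed.

Lemma affine_ge (A B d al be v : R) : d <= A + B * al -> d <= A + B * be ->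
  al <= v <= be -> d <= A + B * v.
Proof.
move=> h1 h2 /andP[h3 h4]; have [B0|B0] := leP 0 B.
  by apply: le_trans h1 _; rewrite lerD2l ler_wpM2l.
by apply: le_trans h2 _; rewrite lerD2l ler_wnM2l// ltW.
Qed.

(** The direction e = p/|p| + q/|q| bisects the angle of the two end points p
    and q, and <p, e> = gap p q / |q|, <q, e> = gap p q / |p|.  The bound
    extends to the segment because v |-> <1 - z v, e> is affine. *)
Lemma separating_direction (al be : R) z (g L : R) :
  al <= be -> 0 < g -> 0 < L ->
  g <= gap (1 - z * al%:C) (1 - z * be%:C) ->
  (forall v : R, al <= v <= be -> normc (1 - z * v%:C) <= L) ->
  exists e, normc e <= 2 /\
    forall v : R, al <= v <= be -> g / L <= dotc (1 - z * v%:C) e.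
Proof.
move=> ab g0 L0; set p := 1 - z * al%:C; set q := 1 - z * be%:C => gpq bL.
have pL : normc p <= L by rewrite bL// lexx ab.
have qL : normc q <= L by rewrite bL// lexx ab.
have p0 : 0 < normc p.
  rewrite normc_gt0; apply/eqP => p0; move: gpq.
  by rewrite /gap /dotc p0 normc0/= !mul0r !addr0 leNgt g0.
have q0 : 0 < normc q.
  rewrite normc_gt0; apply/eqP => q0; move: gpq.
  by rewrite /gap /dotc q0 normc0/= !mulr0 !addr0 leNgt g0.
pose e : Cplx R := (normc p)^-1%:C * p + (normc q)^-1%:C * q.
have de w : dotc w e = dotc w p / normc p + dotc w q / normc q.
  by rewrite dotcC dotcDl !dotcZl !(dotcC w); ring.
exists e; split.
  rewrite (le_trans (normcD _ _))// !normcM !normc_real.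
  by rewrite !gtr0_norm ?invr_gt0// !mulVf ?gt_eqF//; lra.
have dpe : g / L <= dotc p e.
  rewrite de -normc_dotc expr2 mulfK ?gt_eqF//.
  rewrite (_ : _ + _ = gap p q / normc q); last first.
    by rewrite /gap; field; rewrite gt_eqF.
  by apply: ler_pM => //; [exact: ltW|rewrite invr_ge0 ltW|rewrite lef_pV2
    ?posrE].
have dqe : g / L <= dotc q e.
  rewrite de -normc_dotc expr2 mulfK ?gt_eqF// (dotcC q).
  rewrite (_ : _ + _ = gap p q / normc p); last first.
    by rewrite /gap; field; rewrite gt_eqF.
  by apply: ler_pM => //; [exact: ltW|rewrite invr_ge0 ltW|rewrite lef_pV2
    ?posrE].
move=> v vab.
have E u : dotc (1 - z * u%:C) e = complex.Re e + (- dotc z e) * u.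
  by case: (z) (e) => ? ? [? ?]; rewrite /dotc/=; ring.
by rewrite E; apply: affine_ge vab; rewrite -E.
Qed.

Lemma continuous_gap (al be : R) :
  continuous (fun z : Cplx R => gap (1 - z * al%:C) (1 - z * be%:C)).
Proof.
have FF (z : Cplx R) : Filter (nbhs z) := nbhs_filter z.
have cp (r : R) : continuous (fun z : Cplx R => normc (1 - z * r%:C)).
  apply: (@continuous_normcP _ _ `|r|) => z w.
  have H (a b : Cplx R) : normc a - normc b <= normc (a - b).
    by rewrite lerBlDr -{1}(subrK b a) normcD.
  have E : `|r| * normc (z - w) = normc (1 - z * r%:C - (1 - w * r%:C)).
    rewrite mulrC -normc_real -normcM -normcN; congr normc; ring.
  rewrite E ler_norml; apply/andP; split; last exact: H.
  by rewrite lerNl opprB -[leRHS]normcN opprB; exact: H.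
have Rp (r : R) : continuous (fun z : Cplx R => complex.Re (1 - z * r%:C)).
  have -> : (fun z : Cplx R => complex.Re (1 - z * r%:C)) =
      (fun z => 1 - complex.Re z * r).
    by apply/funext => -[? ?] /=; ring.
  move=> z; apply: cvgB; first exact: cvg_cst.
  by apply: cvgM; [exact: continuous_Re|exact: cvg_cst].
have Ip (r : R) : continuous (fun z : Cplx R => complex.Im (1 - z * r%:C)).
  have -> : (fun z : Cplx R => complex.Im (1 - z * r%:C)) =
      (fun z => - (complex.Im z * r)).
    by apply/funext => -[? ?] /=; ring.
  move=> z; apply: cvgN.
  by apply: cvgM; [exact: continuous_Im|exact: cvg_cst].
move=> z; apply: cvgD; first by apply: cvgM; exact: cp.
by apply: cvgD; apply: cvgM; [exact: Rp|exact: Rp|exact: Ip|exact: Ip].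
Qed.

Lemma compact_normc_bounded (A : set (Cplx R)) : compact A ->
  exists2 L : R, 0 < L & forall z, A z -> normc z <= L.
Proof.
move=> cA; have [A0|/nonemptyPn A0] := pselect (A !=set0); last first.
  by exists 1 => // z; rewrite A0.
have [|c _ H] := compact_EVT_max A0 cA (f := @normc R : Cplx R -> R).
  exact/continuous_subspaceT/continuous_normc.
exists (normc c + 1); first by rewrite ltr_pwDr// normc_ge0.
by move=> z /mem_set/H /le_trans; apply; rewrite lerDl.
Qed.

(** With e the bisecting direction at z, |1 - z v| <= L and d <= <1 - z v, e>
    on the segment, take c = T e.  Then
    |c - w|^2 = |c|^2 - 2 T <w, e> + |w|^2 <= |c|^2 - 2 T d + L^2,
    which is |c|^2 - T d for T = L^2 / d, and T d is a fixed fraction of |c|^2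
    because |e| <= 2.  The constants L and d are uniform over A: the first by
    boundedness, the second because the gap attains a positive minimum. *)
Lemma uniform_centre (al be : R) (A : set (Cplx R)) : al <= be -> compact A ->
  (forall z, A z -> forall v : R, al <= v <= be -> 1 - z * v%:C != 0) ->
  exists th d : R, [/\ 0 < th < 1, 0 < d &
    forall z, A z -> exists2 c : Cplx R, c != 0 &
      forall v : R, al <= v <= be ->
        normc (c - (1 - z * v%:C)) ^+ 2 <= th * normc c ^+ 2 /\
        d <= normc (1 - z * v%:C)].
Proof.
move=> ab cA Az; have [A0|/nonemptyPn A0] := pselect (A !=set0); last first.
  by exists (1/2), 1; split => //; [lra|rewrite A0].
have [L0 L00 AL0] := compact_normc_bounded cA.
have [|z0 /set_mem Az0 Hg] := compact_EVT_min A0 cA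
    (f := fun z : Cplx R => gap (1 - z * al%:C) (1 - z * be%:C)).
  exact/continuous_subspaceT/continuous_gap.
set g := gap _ _ in Hg.
have g0 : 0 < g by apply: gap_gt0 => // v; exact: Az.
pose m := Num.max `|al| `|be|; pose L := 1 + L0 * m.
have m0 : 0 <= m by rewrite /m le_max normr_ge0.
have Lgt0 : 0 < L by rewrite /L ltr_pwDl// mulr_ge0// ltW.
have bL z v : A z -> al <= v <= be -> normc (1 - z * v%:C) <= L.
  move=> /AL0 zL vab; rewrite (le_trans (normcB _ _))// normc1 lerD2l.
  rewrite normcM normc_real ler_pM ?normc_ge0//.
  move: vab => /andP[v1 v2]; rewrite /m le_max.
  have [v0|v0] := leP 0 v; apply/orP; [right|left].
    by rewrite (ger0_norm v0) (le_trans v2)// ler_norm.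
  by rewrite (ltr0_norm v0) -normrN (le_trans _ (ler_norm _))// lerN2.
pose d := g / L; have d0 : 0 < d by rewrite divr_gt0.
pose T := L ^+ 2 / d; have T0 : 0 < T by rewrite divr_gt0// exprn_gt0.
pose s := d / (4 * T); have s0 : 0 < s by rewrite divr_gt0// mulr_gt0.
(* 1 / (1 + s) dominates 1 - s and lies in (0, 1) for every s > 0. *)
exists (1 + s)^-1, (d / 2); split.
- rewrite invr_gt0 invf_lt1; lra.
- by rewrite divr_gt0.
move=> z zA.
have [] := @separating_direction al be z g L ab g0 Lgt0.
- by apply: Hg; exact/mem_set.
- by move=> v; exact: bL.
move=> e [e2 He].
have dle v : al <= v <= be -> d <= normc (1 - z * v%:C) * normc e.
  by move=> /He h; apply: le_trans h _;
    apply: le_trans (ler_norm _) (dotc_le _ _).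
have ne0 : 0 < normc e.
  rewrite lt_def normc_ge0 andbT; apply/eqP => e0.
  by have := dle al; rewrite lexx ab e0 mulr0 leNgt d0 => /(_ isT).
exists (T%:C * e).
  by rewrite -normc_gt0 normcM normc_real mulr_gt0// gtr0_norm.
move=> v vab; split; last first.
  rewrite ler_pdivrMr//; apply: le_trans (dle _ vab) _.
  by rewrite ler_wpM2l// normc_ge0.
have := He _ vab; have := bL _ _ zA vab; have := normc_ge0 (1 - z * v%:C).
set w := 1 - z * v%:C => w0 wL dw.
have -> : normc (T%:C * e - w) ^+ 2 =
    normc w ^+ 2 - 2 * T * dotc w e + T ^+ 2 * normc e ^+ 2.
  rewrite !sqr_normc /dotc; case: (w) (e) => ? ? [? ?] /=; ring.
have -> : normc (T%:C * e) ^+ 2 = T ^+ 2 * normc e ^+ 2.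
  by rewrite normcM normc_real exprMn gtr0_norm.
have TL : T * d = L ^+ 2 by rewrite /T divfK// gt_eqF.
have Ts : T ^+ 2 * 4 * s = T * d.
  by rewrite /s; field; rewrite gt_eqF.
rewrite ler_pdivlMl; last by lra.
rewrite mulrC.
set E := normc e ^+ 2.
have E4 : E <= 4 by rewrite /E; nra.
have E0 : 0 <= E by rewrite sqr_ge0.
have w2 : normc w ^+ 2 <= T * d by rewrite TL; nra.
have dw' : T * d <= T * dotc w e by rewrite ler_pM2l.
set W := normc w ^+ 2 in w2 *.
have h1 : W - 2 * T * dotc w e + T ^+ 2 * E <= T ^+ 2 * E - T * d by lra.
apply: (@le_trans _ _ ((T ^+ 2 * E - T * d) * (1 + s))).
  by rewrite ler_wpM2r//; lra.
have h2 : T ^+ 2 * E * s <= T * d.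
  rewrite -Ts ler_wpM2r//; first exact: ltW.
  by rewrite ler_wpM2l// sqr_ge0.
have h3 : 0 <= T * d * s by apply: mulr_ge0; [apply: mulr_ge0|]; exact: ltW.
rewrite mulrDr mulr1 mulrBl; lra.
Qed.
End separation.

(** * Complex-valued measurable and integrable functions *)

Section complex_functions.
Context {R : realType} d (T : measurableType d).
Implicit Types f g : T -> Cplx R.

Definition Cmeasurable f : Prop :=
  measurable_fun setT (fun x => complex.Re (f x)) /\
  measurable_fun setT (fun x => complex.Im (f x)).

Lemma Cmeasurable_cst (c : Cplx R) : Cmeasurable (fun _ => c).
Proof. by split; exact: measurable_cst. Qed.

Lemma Cmeasurable_real (f : T -> R) :
  measurable_fun setT f -> Cmeasurable (fun x => (f x)%:C : Cplx R).
Proof. by move=> mf; split => //=; exact: measurable_cst. Qed.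

Lemma CmeasurableD f g : Cmeasurable f -> Cmeasurable g ->
  Cmeasurable (fun x => f x + g x).
Proof.
move=> [f1 f2] [g1 g2]; split.
  rewrite (_ : (fun _ => _) = (fun x => complex.Re (f x) + complex.Re (g x))).
    exact: measurable_funD.
  by apply/funext => x; case: (f x) (g x) => ? ? [].
rewrite (_ : (fun _ => _) = (fun x => complex.Im (f x) + complex.Im (g x))).
  exact: measurable_funD.
by apply/funext => x; case: (f x) (g x) => ? ? [].
Qed.

Lemma CmeasurableM f g : Cmeasurable f -> Cmeasurable g ->
  Cmeasurable (fun x => f x * g x).
Proof.
move=> [f1 f2] [g1 g2]; split.
  rewrite (_ : (fun _ => _) = (fun x => complex.Re (f x) * complex.Re (g x) -
    complex.Im (f x) * complex.Im (g x))).
    by apply: measurable_funB; exact: measurable_funM.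
  by apply/funext => x; case: (f x) (g x) => ? ? [].
rewrite (_ : (fun _ => _) = (fun x => complex.Re (f x) * complex.Im (g x) +
    complex.Im (f x) * complex.Re (g x))).
  by apply: measurable_funD; exact: measurable_funM.
by apply/funext => x; case: (f x) (g x) => ? ? [].
Qed.

Lemma CmeasurableB f g : Cmeasurable f -> Cmeasurable g ->
  Cmeasurable (fun x => f x - g x).
Proof.
move=> mf mg; rewrite (_ : (fun _ => _) = (fun x => f x + (-1) * g x)).
  by apply: CmeasurableD => //; apply: CmeasurableM => //;
    exact: Cmeasurable_cst.
by apply/funext => x; rewrite mulN1r.
Qed.

Lemma CmeasurableX f n : Cmeasurable f -> Cmeasurable (fun x => f x ^+ n).
Proof.
move=> mf; elim: n => [|n IH]; first exact: Cmeasurable_cst.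
rewrite (_ : (fun _ => _) = (fun x => f x * f x ^+ n));
  first exact: CmeasurableM.
by apply/funext => x; rewrite exprS.
Qed.

Lemma CmeasurableV f : Cmeasurable f -> Cmeasurable (fun x => (f x)^-1).
Proof.
move=> [f1 f2].
have mN : measurable_fun setT
    (fun x => (complex.Re (f x) ^+ 2 + complex.Im (f x) ^+ 2)^-1).
  apply: (measurableT_comp measurable_inv_real).
  by apply: measurable_funD; exact: measurable_funX.
split.
  rewrite (_ : (fun _ => _) = (fun x => complex.Re (f x) *
    (complex.Re (f x) ^+ 2 + complex.Im (f x) ^+ 2)^-1)).
    exact: measurable_funM.
  by apply/funext => x; case: (f x).
rewrite (_ : (fun _ => _) = (fun x => - (complex.Im (f x) *
    (complex.Re (f x) ^+ 2 + complex.Im (f x) ^+ 2)^-1))).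
  by apply: measurableT_comp => //; exact: measurable_funM.
by apply/funext => x; case: (f x).
Qed.

Lemma Cmeasurable_sum n (f : 'I_n -> T -> Cplx R) :
  (forall i, Cmeasurable (f i)) -> Cmeasurable (fun x => \sum_(i < n) f i x).
Proof.
elim: n f => [|n IH] f mf.
  rewrite (_ : (fun _ => _) = (fun=> 0)); first exact: Cmeasurable_cst.
  by apply/funext => x; rewrite big_ord0.
rewrite (_ : (fun _ => _) = (fun x =>
  \sum_(i < n) f (widen_ord (leqnSn n) i) x + f ord_max x)).
  by apply: CmeasurableD => //; exact: IH.
by apply/funext => x; rewrite big_ord_recr.
Qed.

Variable m : {measure set T -> \bar R}.

Definition Cintegrable f : Prop :=
  m.-integrable setT (fun x => (complex.Re (f x))%:E) /\
  m.-integrable setT (fun x => (complex.Im (f x))%:E).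

Lemma CintegrableD f g : Cintegrable f -> Cintegrable g ->
  Cintegrable (fun x => f x + g x).
Proof.
move=> [f1 f2] [g1 g2]; split.
  rewrite (_ : (fun _ => _) =
    (fun x => (complex.Re (f x))%:E + (complex.Re (g x))%:E)%E).
    exact: integrableD.
  by apply/funext => x; case: (f x) (g x) => ? ? [].
rewrite (_ : (fun _ => _) =
  (fun x => (complex.Im (f x))%:E + (complex.Im (g x))%:E)%E).
  exact: integrableD.
by apply/funext => x; case: (f x) (g x) => ? ? [].
Qed.

Lemma CintegralD f g : Cintegrable f -> Cintegrable g ->
  Cintegral m (fun x => f x + g x) = Cintegral m f + Cintegral m g.
Proof.
move=> [f1 f2] [g1 g2]; rewrite /Cintegral; simpc.
rewrite -!RintegralD//; congr (_ +i* _); apply: eq_Rintegral => x _.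
  by case: (f x) (g x) => ? ? [].
by case: (f x) (g x) => ? ? [].
Qed.

Lemma CintegrableZl (c : Cplx R) f : Cintegrable f ->
  Cintegrable (fun x => c * f x).
Proof.
move=> [f1 f2]; split.
  rewrite (_ : (fun _ => _) = (fun x => (complex.Re c)%:E * (complex.Re (f
    x))%:E -
    (complex.Im c)%:E * (complex.Im (f x))%:E)%E).
    by apply: integrableB => //; exact: integrableZl.
  by apply/funext => x; case: (c) (f x) => ? ? [].
rewrite (_ : (fun _ => _) = (fun x => (complex.Re c)%:E * (complex.Im (f
  x))%:E +
  (complex.Im c)%:E * (complex.Re (f x))%:E)%E).
  by apply: integrableD => //; exact: integrableZl.
by apply/funext => x; case: (c) (f x) => ? ? [].
Qed.

Lemma CintegralZl (c : Cplx R) f : Cintegrable f ->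
  Cintegral m (fun x => c * f x) = c * Cintegral m f.
Proof.
move=> [f1 f2]; rewrite /Cintegral; case: c => a b.
have Z r (h : T -> R) : m.-integrable setT (fun x => (h x)%:E) ->
    m.-integrable setT (fun x => (r * h x)%:E).
  exact: integrableZl.
simpc; rewrite -!RintegralZl// -RintegralB//; [|exact: Z|exact: Z].
rewrite -RintegralD//; [|exact: Z|exact: Z].
by congr (_ +i* _); apply: eq_Rintegral => x _; case: (f x).
Qed.

Lemma CintegralB f g : Cintegrable f -> Cintegrable g ->
  Cintegral m (fun x => f x - g x) = Cintegral m f - Cintegral m g.
Proof.
move=> If Ig; rewrite -[in RHS]mulN1r -CintegralZl//.
rewrite -CintegralD//; last exact: CintegrableZl.
by congr Cintegral; apply/funext => x; rewrite mulN1r.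
Qed.

Lemma Cintegrable_sum n (f : 'I_n -> T -> Cplx R) :
  (forall i, Cintegrable (f i)) -> Cintegrable (fun x => \sum_(i < n) f i x).
Proof.
elim: n f => [|n IH] f mf.
  rewrite (_ : (fun _ => _) = (fun=> 0)).
    by split; exact: integrable0.
  by apply/funext => x; rewrite big_ord0.
rewrite (_ : (fun _ => _) = (fun x =>
  \sum_(i < n) f (widen_ord (leqnSn n) i) x + f ord_max x)).
  by apply: CintegrableD => //; exact: IH.
by apply/funext => x; rewrite big_ord_recr.
Qed.

Lemma Cintegral_sum n (f : 'I_n -> T -> Cplx R) :
  (forall i, Cintegrable (f i)) ->
  Cintegral m (fun x => \sum_(i < n) f i x) = \sum_(i < n) Cintegral m (f i).
Proof.
elim: n f => [|n IH] f mf.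
  rewrite big_ord0 (_ : (fun _ => _) = (fun=> 0)).
    by rewrite /Cintegral /Rintegral/= integral0.
  by apply/funext => x; rewrite big_ord0.
rewrite big_ord_recr/= -IH// -CintegralD//; last exact: Cintegrable_sum.
by congr Cintegral; apply/funext => x; rewrite big_ord_recr.
Qed.

(** From here on m is a finite measure carried by D; the functions met below,
    such as v |-> 1 / (1 - z v), are controlled on D only. *)
Variable D : set T.
Hypotheses (mD : measurable D) (mD0 : m (~` D) = 0%E) (mfin : (m setT < +oo)%E).

Lemma integrable_bounded_on (f : T -> R) (B : R) : measurable_fun setT f ->
  (forall x, D x -> `|f x| <= B) -> m.-integrable setT (fun x => (f x)%:E).
Proof.
move=> mf fB; apply/(negligible_integrable (measurableC mD)) => //.
  exact/measurable_EFinP.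
rewrite setTD setCK; apply: measurable_bounded_integrable => //.
- by rewrite (le_lt_trans _ mfin)// le_measure ?inE.
- exact: measurable_funTS.
exists B; split; first exact: num_real.
by move=> M BM x Dx; apply: (le_trans (fB _ Dx)); exact: ltW.
Qed.

Lemma Rintegral_bounded_on (f : T -> R) (B : R) : measurable_fun setT f ->
  (forall x, D x -> `|f x| <= B) -> `|\int[m]_x f x| <= B * fine (m setT).
Proof.
move=> mf fB; have fi := integrable_bounded_on mf fB.
rewrite (le_trans (le_normr_Rintegral measurableT fi))//.
have mDT : m D = m setT.
  rewrite -(setvU D) measureU//; [|exact: measurableC|exact: setICl].
  by rewrite -[LHS]add0e; congr (_ + _)%E; exact: esym mD0.
have mDfin : (m D < +oo)%E by rewrite mDT.
rewrite /Rintegral (ge0_negligible_integral (measurableC mD))//; last first.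
  exact/measurable_EFinP/measurableT_comp.
rewrite setTD setCK -mDT -/(Rintegral m D (fun x => `|f x|)).
rewrite -(Rintegral_cst _ mD); apply: le_Rintegral => //.
- have /integrable_norm/(integrableS measurableT mD) := fi; exact.
- apply: measurable_bounded_integrable => //.
  by exists `|B|; split; [exact: num_real|move=> M BM x _; exact: ltW].
Qed.

Lemma Cintegrable_bounded_on f (B : R) : Cmeasurable f ->
  (forall x, D x -> normc (f x) <= B) -> Cintegrable f.
Proof.
move=> [f1 f2] fB; split; apply: (@integrable_bounded_on _ B) => // x Dx.
  exact: le_trans (Re_le_normc _) (fB _ Dx).
exact: le_trans (Im_le_normc _) (fB _ Dx).
Qed.

(** The factor 2 comes from adding the bounds of the real and of the imaginary
    part. *)
Lemma Cintegral_bounded_on f (B : R) : Cmeasurable f ->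
  (forall x, D x -> normc (f x) <= B) ->
  normc (Cintegral m f) <= 2 * B * fine (m setT).
Proof.
move=> [f1 f2] fB; rewrite (le_trans (normc_le_ReIm _))//=.
rewrite -mulrA mulr_natl mulr2n lerD//; apply: Rintegral_bounded_on => // x Dx.
  exact: le_trans (Re_le_normc _) (fB _ Dx).
exact: le_trans (Im_le_normc _) (fB _ Dx).
Qed.

End complex_functions.

(** * The error of Gaussian quadrature *)

Section quadrature_error.
Context {R : realType}.
Variables (nu : {measure set R -> \bar R}) (al be : R).
Hypotheses (nu0 : nu (~` `[al, be]) = 0%E) (nufin : (nu setT < +oo)%E).

Let mass := fine (nu setT).

Lemma power_integrable k : nu.-integrable setT (fun v : R => (v ^+ k)%:E).
Proof.
apply: (@integrable_bounded_on _ _ _ nu _ _ nu0 nufin (fun v => v ^+ k)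
  ((`|al| + `|be|) ^+ k)) => //.
move=> v /=; rewrite in_itv/= => /andP[av vb];
  rewrite normrX lerXn2r ?nnegrE ?addr_ge0//.
rewrite ler_norml; apply/andP; split.
  by rewrite lerNl (le_trans _ (_ : - al <=
    _))// ?lerN2// -normrN (le_trans (ler_norm _))// lerDl.
by rewrite (le_trans vb)// (le_trans (ler_norm _))// lerDr.
Qed.

Lemma CX_integrable (c : Cplx R) k :
  Cintegrable nu (fun v : R => c * v%:C ^+ k).
Proof.
apply: CintegrableZl; rewrite (_ : (fun _ => _) = fun v : R => (v ^+ k)%:C).
  by split => /=; [exact: power_integrable|exact: integrable0].
by apply/funext => v; rewrite rmorphXn.
Qed.

Variables (n : nat) (x w : 'I_n -> R).
Hypotheses (n_gt0 : (0 < n)%N)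
  (xw : gauss_quadrature nu `[al, be] x w).

(** Exactness on the constants. *)
Lemma sum_weights : \sum_(i < n) w i = mass.
Proof.
have [_ _ _ /(_ 0%N)] := xw; rewrite muln_gt0 n_gt0 => /(_ isT).
rewrite (_ : (\int[nu]_v (v ^+ 0)%:E)%E = nu setT); last first.
  by under eq_integral do rewrite expr0; rewrite integral_cst// mul1e.
by rewrite /mass => ->/=; apply: eq_bigr => i _; rewrite expr0 mul1r.
Qed.

(** The moments are real, but exactness extends to complex coefficients by
    linearity. *)
Lemma gauss_quadrature_poly (p : {poly R[i]}) : (size p <= 2 * n)%N ->
  Cintegral nu (fun v => p.[v%:C]) = \sum_(i < n) (w i)%:C * p.[(x i)%:C].
Proof.
move=> pn; rewrite (_ : (fun _ => _) =
    (fun v : R => \sum_(k < 2 * n) p`_k * v%:C ^+ k)); last first.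
  by apply/funext => v; rewrite (horner_coef_wide _ pn).
rewrite Cintegral_sum; last by move=> k; exact: CX_integrable.
under [RHS]eq_bigr do rewrite (horner_coef_wide _ pn) mulr_sumr.
rewrite exchange_big/=; apply: eq_bigr => k _.
have := CX_integrable 1 k; rewrite (_ : (fun _ => _) =
  fun v : R => v%:C ^+ k); last first.
  by apply/funext => v; rewrite mul1r.
move=> ik; rewrite CintegralZl//.
under [RHS]eq_bigr do rewrite mulrCA.
rewrite -mulr_sumr; congr (_ * _).
have [_ _ _ /(_ k (ltn_ord k)) E] := xw.
rewrite /Cintegral; under eq_Rintegral do rewrite -rmorphXn/=.
under [X in _ +i* X]eq_Rintegral do rewrite -rmorphXn/=.
rewrite /Rintegral E/= integral0/=.
rewrite -[LHS]/((\sum_(i < n) x i ^+ k * w i)%:C) rmorph_sum/=.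
by apply: eq_bigr => i _; rewrite rmorphM rmorphXn mulrC.
Qed.

(** The rule and the integral agree on p, so the error for f is that for f - p:
    the positive weights contribute mass * eps, the integral 2 * mass * eps. *)
Lemma gauss_quadrature_error (f : R -> Cplx R) (p : {poly R[i]}) (eps : R) :
  Cmeasurable f -> Cintegrable nu f -> (size p <= 2 * n)%N ->
  (forall v, al <= v <= be -> normc (f v - p.[v%:C]) <= eps) ->
  normc (\sum_(i < n) (w i)%:C * f (x i) - Cintegral nu f) <= 3 * mass * eps.
Proof.
move=> mf fi pn fp.
have [_ xI w0 _] := xw.
pose P v : Cplx R := p.[v%:C].
have PE : P = (fun v : R => \sum_(k < 2 * n) p`_k * v%:C ^+ k).
  by apply/funext => v; rewrite /P (horner_coef_wide _ pn).
have Pi : Cintegrable nu P.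
  by rewrite PE; apply: Cintegrable_sum => k; exact: CX_integrable.
have mP : Cmeasurable P.
  rewrite PE; apply: Cmeasurable_sum => k; apply: CmeasurableM.
    exact: Cmeasurable_cst.
  by apply: CmeasurableX; apply: Cmeasurable_real.
rewrite (_ : _ - _ = \sum_(i < n) (w i)%:C * (f (x i) - P (x i)) -
    Cintegral nu (fun v => f v - P v)); last first.
  rewrite CintegralB// gauss_quadrature_poly//.
  under [in RHS]eq_bigr do rewrite mulrBr.
  by rewrite sumrB /P opprB addrA subrK.
rewrite (le_trans (normcB _ _))//.
rewrite (_ : 3 * mass * eps = mass * eps + 2 * eps * mass); last by ring.
rewrite lerD//; last first.
  apply: (Cintegral_bounded_on _ nu0 nufin) => //; exact: CmeasurableB.
rewrite -sum_weights mulr_suml.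
apply: le_trans (_ : \sum_(i < n) normc ((w i)%:C * (f (x i) - P (x i))) <= _).
  elim/big_ind2 : _ => //; first by rewrite normc0.
  by move=> a b c d ab cd; rewrite (le_trans (normcD _ _))// lerD.
apply: ler_sum => i _; rewrite normcM normc_real ger0_norm; last exact/ltW/w0.
by rewrite ler_wpM2l ?(ltW (w0 _))// fp//; have := xI i; rewrite /= in_itv.
Qed.

End quadrature_error.

Section kernel.
Context {R : realType}.

Lemma Cmeasurable_kernel (z : Cplx R) :
  Cmeasurable (fun v : R => (1 - z * v%:C)^-1 : Cplx R).
Proof.
apply: CmeasurableV; apply: CmeasurableB; first exact: Cmeasurable_cst.
apply: CmeasurableM; first exact: Cmeasurable_cst.
exact: Cmeasurable_real.
Qed.

(** Truncating the expansion of 1/w around c, with w = 1 - z v, after 2n terms.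
    An even number of terms turns the bound on |(c - w)/c|^2 into theta^n
    without a square root. *)
Lemma kernel_poly_approx (al be th d : R) (z c : Cplx R) (n : nat) :
  0 < d -> 0 <= th -> c != 0 ->
  (forall v : R, al <= v <= be ->
     normc (c - (1 - z * v%:C)) ^+ 2 <= th * normc c ^+ 2 /\
     d <= normc (1 - z * v%:C)) ->
  exists2 p : {poly R[i]}, (size p <= 2 * n)%N &
    forall v : R, al <= v <= be ->
      normc ((1 - z * v%:C)^-1 - p.[v%:C] : Cplx R) <= th ^+ n / d.
Proof.
move=> d0 th0 c0 H.
exists (\sum_(k < 2 * n) (c ^+ k.+1)^-1 *: ((c - 1)%:P + z *: 'X) ^+ k).
  apply: (leq_trans (size_sum _ _ _)); apply/bigmax_leqP => k _.
  rewrite (leq_trans (size_scale_leq _ _))// (leq_trans (size_exp_leq _ _))//.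
  rewrite (leq_trans _ (ltn_ord k))// ltnS -[leqRHS]mul1n leq_mul2r;
    apply/orP; right.
  rewrite -subn1 leq_subLR (leq_trans (size_polyD _ _))// geq_max.
  rewrite (leq_trans (size_polyC_leq1 _))//= (leq_trans (size_scale_leq _ _))//.
  by rewrite size_polyX.
move=> v vab; have [h1 h2] := H _ vab.
set w := 1 - z * v%:C in h1 h2 *.
have w0 : w != 0 by rewrite -normc_gt0 (lt_le_trans d0).
rewrite horner_sum (geometric_remainder (2 * n) c0 w0).
rewrite [X in normc X](_ : _ = ((c - w) / c) ^+ (2 * n) / w); last first.
  rewrite addrAC -[RHS]add0r; congr (_ + _); apply/eqP; rewrite subr_eq0;
    apply/eqP.
  apply: eq_bigr => k _; rewrite !hornerE [RHS]mulrC; congr (_ * _).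
  by congr (_ ^+ _); rewrite /w; ring.
rewrite normcM normcV normcX exprM ler_pM ?invr_ge0 ?normc_ge0//.
- by rewrite exprn_ge0// exprn_ge0// normc_ge0.
- rewrite lerXn2r ?nnegrE ?sqr_ge0// normcM normcV exprMn exprVn ler_pdivrMr//.
  by rewrite exprn_gt0// normc_gt0.
- by rewrite lef_pV2 ?posrE// (lt_le_trans d0).
Qed.

End kernel.

(** * Analytic germs and the identity principle *)

Section analytic_germs.
Context {R : realType}.
Implicit Types (f g : Cplx R -> Cplx R) (z : Cplx R).

Lemma cvg_normcP (u : nat -> Cplx R) (l : Cplx R) :
  u @ \oo --> l <->
  forall e : R, 0 < e -> exists N, forall n, (N <= n)%N -> normc (u n - l) < e.
Proof.
split.
  move=> /cvgrPdist_lt ul e e0; have /ul[N _ H] : 0 < e%:C by rewrite ltcR.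
  exists N => n Nn; have := H n Nn.
  by rewrite distrC normrE_normc ltcR.
move=> H; apply/cvgrPdist_lt => e e0.
have e1 : 0 < complex.Re e by move: e0; rewrite ltcE => /andP[].
have [N HN] := H _ e1; exists N => // n /HN h.
rewrite distrC normrE_normc; move: e0.
by rewrite !ltcE /= => /andP[/eqP -> _]; rewrite eqxx.
Qed.

(** The condition that [analytic_on] imposes at each point of its domain. *)
Definition analytic_at z0 f := exists c : nat -> Cplx R,
  \forall z \near z0, series (fun k => c k * (z - z0) ^+ k) @ \oo --> f z.

Lemma analytic_atB z0 f g : analytic_at z0 f -> analytic_at z0 g ->
  analytic_at z0 (fun z => f z - g z).
Proof.
move=> [a fa] [b gb]; exists (fun k => a k - b k).
have FF : Filter (nbhs z0) := nbhs_filter z0.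
apply: (@filterS2 _ _ FF _ _ _ _ fa gb) => z {}fa {}gb.
have E : series (fun k => (a k - b k) * (z - z0) ^+ k) =
    (fun n => series (fun k => a k * (z - z0) ^+ k) n -
              series (fun k => b k * (z - z0) ^+ k) n).
  apply/funext => n; rewrite /series/= -sumrB; apply: eq_bigr => k _.
  by rewrite mulrBl.
rewrite E; exact: cvgB fa gb.
Qed.

Lemma analytic_at_cst z0 (a : Cplx R) : analytic_at z0 (fun=> a).
Proof.
have FF : Filter (nbhs z0) := nbhs_filter z0.
exists (fun k => if k is 0%N then a else 0).
apply: (@nearW _ _ _ FF) => z.
apply/cvg_normcP => e e0; exists 1%N => -[//|n _].
rewrite /series/= big_nat_recl// expr0 mulr1 big1; last by move=> k _;
  rewrite mul0r.
by rewrite addr0 subrr normc0.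
Qed.

(** Write z = z0 + (z - z0): the coefficients are scaled by z0 and shifted. *)
Lemma analytic_at_mulX z0 f : analytic_at z0 f ->
  analytic_at z0 (fun z => z * f z).
Proof.
move=> [c fc]; exists (fun k => z0 * c k + if k is k'.+1 then c k' else 0).
have FF : Filter (nbhs z0) := nbhs_filter z0.
apply: (@filterS _ _ FF _ _ _ fc) => z {}fc.
set u := series _ in fc; set v := series _.
have vE n : v n.+1 = z0 * u n.+1 + (z - z0) * u n.
  rewrite /v /u /series/= big_nat_recl// [in RHS]big_nat_recl//.
  rewrite mulrDr mulr_sumr [in RHS]mulr_sumr -!addrA; congr (_ + _).
    by rewrite !expr0 !mulr1 addr0.
  by rewrite -big_split; apply: eq_bigr => k _/=; rewrite exprS; ring.
have -> : z * f z = z0 * f z + (z - z0) * f z by ring.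
rewrite -(cvg_shiftS v) (_ : (fun n => v n.+1) =
  (fun n => z0 * u n.+1 + (z - z0) * u n)); last by apply/funext.
apply: cvgD; (apply: cvgM; first exact: cvg_cst) => //.
by rewrite (cvg_shiftS u).
Qed.

Lemma analytic_at_drift_sqr z0 f (a : Cplx R) : analytic_at z0 f ->
  analytic_at z0 (fun z => a * z + z ^+ 2 * f z).
Proof.
move=> fa; rewrite (_ : (fun _ => _) = (fun z => z * (z * f z) - z * - a)).
  apply: analytic_atB; first by do 2 apply: analytic_at_mulX.
  by apply: analytic_at_mulX; exact: analytic_at_cst.
by apply/funext => z; ring.
Qed.

(** A power series whose terms are bounded at radius s is Lipschitz at its
    centre, uniformly in the length of the partial sums; the geometric factor
    makes the induction go through. *)
Lemma power_series_head (c : nat -> Cplx R) (B s : R) (h : Cplx R) :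
  0 < s -> (forall j, normc (c j) * s ^+ j <= B) -> normc h <= s / 2 ->
  forall n, normc (\sum_(j < n.+1) c j * h ^+ j - c 0%N) <=
    B * (normc h / s) * (2 - 2 * 2^-1 ^+ n).
Proof.
move=> s0 cB hs; set t := normc h / s.
have t0 : 0 <= t by rewrite divr_ge0 ?normc_ge0// ltW.
have t2 : t <= 2^-1 by rewrite /t ler_pdivrMr// mulrC.
have B0 : 0 <= B by rewrite (le_trans _ (cB 0%N))// expr0 mulr1 normc_ge0.
elim=> [|n IH].
  by rewrite big_ord_recr/= big_ord0 !expr0 add0r !mulr1 !subrr normc0 mulr0.
rewrite big_ord_recr/= addrAC (le_trans (normcD _ _))//.
rewrite (_ : 2 - 2 * _ = 2 - 2 * 2^-1 ^+ n + 2^-1 ^+ n); last first.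
  by rewrite exprS; field.
rewrite mulrDr lerD// normcM normcX.
have -> : normc h = t * s by rewrite /t divfK// gt_eqF.
rewrite exprMn mulrCA mulrC -[leRHS]mulrA ler_pM//.
- by rewrite mulr_ge0// ?normc_ge0// exprn_ge0// ltW.
- exact: exprn_ge0.
by rewrite exprS ler_wpM2l// lerXn2r// nnegrE.
Qed.

Lemma cvg_series_terms_bounded (u : nat -> Cplx R) (l : Cplx R) :
  series u @ \oo --> l -> exists B, forall n, normc (u n) <= B.
Proof.
move=> /cvg_normcP/(_ 1 ltr01)[N HN].
exists (\sum_(i < N) normc (u i) + 2) => n.
have S0 : 0 <= \sum_(i < N) normc (u i) by apply: sumr_ge0 => i _;
  exact: normc_ge0.
have [nN|Nn] := ltnP n N.
  rewrite (bigD1 (Ordinal nN))//= -addrA lerDl addr_ge0// sumr_ge0// => i _.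
  exact: normc_ge0.
have -> : u n = (series u n.+1 - l) - (series u n - l).
  by rewrite /series/= big_nat_recr//=; ring.
have := normcB (series u n.+1 - l) (series u n - l).
have := HN _ Nn; have := HN _ (leqW Nn); lra.
Qed.

(** If the coefficients below k vanish, then f(z) / (z - z0)^k is a power series
    with constant term c k, continuous at z0, that vanishes at the given zeros
    of f arbitrarily close to z0. *)
Lemma coef_eq0_of_zeros (c : nat -> Cplx R) f z0 :
  (\forall z \near z0, series (fun k => c k * (z - z0) ^+ k) @ \oo --> f z) ->
  (forall r : R, 0 < r -> exists z, 0 < normc (z - z0) < r /\ f z = 0) ->
  forall k, c k = 0.
Proof.
move=> /nbhs_normcP[r r0 Hr] zeros.
pose s := r / 2; have s0 : 0 < s by rewrite divr_gt0.
have [B HB] : exists B, forall j, normc (c j) * s ^+ j <= B.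
  have /Hr/cvg_series_terms_bounded[B HB] : normc (z0 + s%:C - z0) < r.
    by rewrite addrAC subrr add0r normc_real gtr0_norm// /s; lra.
  exists B => j; apply: le_trans (HB j).
  by rewrite addrAC subrr add0r normcM normcX normc_real gtr0_norm.
have sne k : s ^+ k != 0 by rewrite expf_neq0// gt_eqF.
elim/ltn_ind => k IH; apply/eqP; rewrite -normc_eq0 eq_le normc_ge0 andbT.
pose B' := B / s ^+ k.
have HB' j : normc (c (k + j)%N) * s ^+ j <= B'.
  by rewrite /B' ler_pdivlMr ?exprn_gt0// -mulrA -exprD addnC HB.
have B'0 : 0 <= B' by rewrite (le_trans _ (HB' 0%N))// mulr_ge0 ?normc_ge0.
apply/ler_addgt0Pl => e e0; rewrite addr0.
(* |z - z0| <= s / 2 for the Lipschitz bound, then at most e / 2. *)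
pose rr := Num.min (s / 2) (e / 2 * s / (2 * B' + 1)).
have B'1 : 0 < 2 * B' + 1 by lra.
have rr0 : 0 < rr by rewrite lt_min !divr_gt0// !mulr_gt0// divr_gt0.
have [z [/andP[h0 hrr] fz0]] := zeros _ rr0.
set h := z - z0 in h0 hrr.
have hs : normc h <= s / 2 by rewrite ltW// (lt_le_trans hrr)// ge_min lexx.
have hne : h != 0 by rewrite -normc_gt0.
have /Hr/cvg_normcP : normc (z - z0) < r by rewrite -/h /s in hs *; lra.
have e2 : 0 < e / 2 * normc h ^+ k by rewrite mulr_gt0 ?exprn_gt0// divr_gt0.
rewrite fz0 => /(_ _ e2)[N HN].
have := HN (k + N.+1)%N; rewrite subr0 -/h.
have -> : series (fun k => c k * h ^+ k) (k + N.+1)%N =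
    h ^+ k * \sum_(j < N.+1) c (k + j)%N * h ^+ j.
  rewrite /series/= big_mkord big_split_ord/= big1 ?add0r; last first.
    by move=> j _; rewrite IH ?mul0r.
  by rewrite mulr_sumr; apply: eq_bigr => j _; rewrite exprD; ring.
rewrite normcM normcX mulrC ltr_pM2r ?exprn_gt0//.
rewrite (leq_trans (leqnSn N)) ?leq_addl// => /(_ isT) hN.
have := power_series_head s0 HB' hs N.
rewrite addn0; set S := \sum_(j < _) _ in hN * => hS.
have hB : B' * (normc h / s) * (2 - 2 * 2^-1 ^+ N) <= e / 2.
  have p0 : 0 <= 2^-1 ^+ N :> R by rewrite exprn_ge0.
  apply: (@le_trans _ _ (B' * (normc h / s) * 2)).
    rewrite ler_wpM2l//; last by lra.
    by rewrite mulr_ge0// divr_ge0 ?normc_ge0// ltW.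
  have : normc h <= e / 2 * s / (2 * B' + 1).
    by rewrite ltW// (lt_le_trans hrr)// ge_min lexx orbT.
  rewrite ler_pdivlMr// => hh.
  rewrite mulrA mulrAC ler_pdivrMr//.
  by have := normc_ge0 h; nra.
have := normcB S (S - c k); rewrite opprB addrC subrK.
lra.
Qed.

Lemma analytic_at_zeros f z0 : analytic_at z0 f ->
  (forall r : R, 0 < r -> exists z, 0 < normc (z - z0) < r /\ f z = 0) ->
  \forall z \near z0, f z = 0.
Proof.
move=> [c fc] zeros; have c0 := coef_eq0_of_zeros fc zeros.
have FF : Filter (nbhs z0) := nbhs_filter z0.
apply: (@filterS _ _ FF _ _ _ fc) => z /cvg_normcP H.
apply/eqP; rewrite -normc_eq0 eq_le normc_ge0 andbT.
apply/ler_addgt0Pl => e e0; rewrite addr0; have [N /(_ N (leqnn N))] := H _ e0.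
rewrite /series/= big1; last by move=> k _; rewrite c0 mul0r.
by rewrite add0r normcN => /ltW.
Qed.

(** The t in [0, 1] such that f vanishes around t z form a set that is open in
    [0, 1] and, by [analytic_at_zeros], closed; it contains 0, so by
    connectedness it contains 1. *)
Lemma identity_segment f z :
  (forall t : R, 0 <= t <= 1 -> analytic_at (t%:C * z) f) ->
  (\forall y \near (0 : Cplx R), f y = 0) -> f z = 0.
Proof.
move=> fa f0.
pose V : set R := [set t | \forall y \near (t%:C * z : Cplx R), f y = 0].
pose B := `[0, 1]%classic `&` V.
have tsz (t s : R) : normc (t%:C * z - s%:C * z) = `|t - s| * normc z.
  by rewrite -mulrBl -rmorphB normcM normc_real.
have k0 : 0 < normc z + 1 by rewrite ltr_pwDr// normc_ge0.
have small (t s e : R) : `|t - s| < e / (normc z + 1) ->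
    normc (t%:C * z - s%:C * z) < e.
  rewrite tsz ltr_pdivlMr//; apply: le_lt_trans.
  by rewrite ler_wpM2l// lerDl.
have : B = `[0, 1]%classic.
  apply: (@segment_connected _ 0 1).
  - exists 0; split; first by rewrite /= in_itv/= lexx ler01.
    by rewrite /V/= mul0r.
  - exists V => //; rewrite openE => t /nbhs_normcP[r r0 Hr].
    apply/nbhs_ballP; exists (r / 2 / (normc z + 1)) => /=.
      by rewrite !divr_gt0.
    move=> s; rewrite -ball_normE/= distrC => /small ts.
    apply/nbhs_normcP; exists (r / 2); first by rewrite divr_gt0.
    move=> y ys; apply: Hr.
    rewrite -(subrK (s%:C * z) y) -addrA.
    by rewrite (le_lt_trans (normcD _ _))//; lra.
  - exists (closure B); first exact: closed_closure.
    apply/seteqP; split => [t [t01 Vt]|t [t01 Bt]].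
      by split; [exact: t01|exact: subset_closure].
    split; first exact: t01.
    have [//|nVt] := pselect (V t).
    apply: analytic_at_zeros; first by apply: fa; move: t01; rewrite /= in_itv.
    move=> r r0.
    have /Bt[s [[s01 Vs]]] : nbhs t (ball t (r / (normc z + 1))).
      by apply: nbhsx_ballx; rewrite divr_gt0.
    rewrite -ball_normE/= distrC => /small sr.
    exists (s%:C * z); split; last exact: nbhs_singleton Vs.
    rewrite sr andbT normc_gt0 subr_eq0; apply/eqP => st; apply: nVt.
    by rewrite /V/= -st.
move=> /seteqP[_ /(_ 1)] /=; rewrite in_itv/= lexx ler01 => /(_ isT)[_].
by rewrite /V/= mul1r => /nbhs_singleton.
Qed.

End analytic_germs.

Section kernel_integral.
Context {R : realType}.
Variables (nu : {measure set R -> \bar R}) (al be : R).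
Hypotheses (nu0 : nu (~` `[al, be]) = 0%E) (nufin : (nu setT < +oo)%E).

(** For z close to z0 the remainder of the expansion of 1 / (1 - z v) in powers
    of z - z0 is at most 2^-N / (d / 2), uniformly in v, so the expansion can be
    integrated term by term. *)
Lemma kernel_integral_analytic (z0 : Cplx R) (d : R) : 0 < d ->
  (forall v : R, al <= v <= be -> d <= normc (1 - z0 * v%:C)) ->
  analytic_at z0 (fun z => Cintegral nu (fun v => (1 - z * v%:C)^-1)).
Proof.
move=> d0 Hd; pose m := `|al| + `|be| + 1.
have m0 : 0 < m by rewrite ltr_pwDr// addr_ge0.
have vm v : al <= v <= be -> `|v| <= m.
  move=> /andP[av vb]; have := ler_norm (- al); have := ler_norm be.
  rewrite normrN ler_norml /m; have := normr_ge0 al; have := normr_ge0 be.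
  by move=> *; apply/andP; split; lra.
have mk z : Cmeasurable (fun v : R => 1 - z * v%:C : Cplx R).
  apply: CmeasurableB; first exact: Cmeasurable_cst.
  by apply: CmeasurableM; [exact: Cmeasurable_cst|exact: Cmeasurable_real].
pose e k (v : R) : Cplx R := v%:C ^+ k * (1 - z0 * v%:C)^-1 ^+ k.+1.
have me k : Cmeasurable (e k).
  apply: CmeasurableM; first by apply: CmeasurableX; exact: Cmeasurable_real.
  by apply: CmeasurableX; exact: CmeasurableV.
have ie k : Cintegrable nu (e k).
  apply: (@Cintegrable_bounded_on _ _ _ _ _ _ nu0 nufin _ (m ^+ k * d^-1 ^+
    k.+1)) => //.
  move=> v; rewrite /= in_itv/= => vI.
  rewrite /e normcM !normcX normc_real normcV.
  have h1 := Hd _ vI; have h2 := vm _ vI.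
  rewrite ler_pM ?exprn_ge0 ?invr_ge0 ?normc_ge0//.
    by rewrite lerXn2r ?nnegrE// ltW.
  by rewrite lerXn2r ?nnegrE ?invr_ge0 ?normc_ge0 ?(ltW d0)//
    lef_pV2 ?posrE// (lt_le_trans d0).
exists (fun k => Cintegral nu (e k)).
apply/nbhs_normcP; exists (d / (2 * m)); first by rewrite divr_gt0// mulr_gt0.
move=> z; set h := z - z0 => hd.
have hm : normc h * m <= d / 2.
  by move: hd; rewrite invfM mulrA ltr_pdivlMr// => /ltW.
have Hw v : al <= v <= be -> d / 2 <= normc (1 - z * v%:C).
  move=> vI; have h1 := Hd _ vI; have h2 := vm _ vI.
  have : normc (h * v%:C) <= d / 2.
    by rewrite normcM normc_real (le_trans _ hm)// ler_wpM2l// normc_ge0.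
  have := normcD (1 - z * v%:C) (h * v%:C).
  rewrite (_ : 1 - z * v%:C + h * v%:C = 1 - z0 * v%:C); last by rewrite /h;
    ring.
  lra.
pose S N (v : R) : Cplx R := \sum_(k < N) h ^+ k * e k v.
have iS N : Cintegrable nu (S N).
  by apply: Cintegrable_sum => k; exact: CintegrableZl.
have mS N : Cmeasurable (S N).
  by apply: Cmeasurable_sum => k; apply: CmeasurableM => //;
    exact: Cmeasurable_cst.
have iK : Cintegrable nu (fun v => (1 - z * v%:C)^-1 : Cplx R).
  apply: (@Cintegrable_bounded_on _ _ _ _ _ _ nu0 nufin _ (d / 2)^-1) => //.
    exact: CmeasurableV.
  move=> v; rewrite /= in_itv/= => /Hw vI;
    rewrite normcV lef_pV2 ?posrE ?divr_gt0//.
  by rewrite (lt_le_trans _ vI)// divr_gt0.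
have SE N : series (fun k => Cintegral nu (e k) * h ^+ k) N =
  Cintegral nu (S N).
  rewrite Cintegral_sum; last by move=> k; exact: CintegrableZl.
  by rewrite /series/= big_mkord; apply: eq_bigr => k _;
    rewrite CintegralZl// mulrC.
have rem N : normc (series (fun k => Cintegral nu (e k) * h ^+ k) N -
    Cintegral nu (fun v => (1 - z * v%:C)^-1)) <=
    2 * (2^-1 ^+ N / (d / 2)) * fine (nu setT).
  rewrite SE -CintegralB//.
  apply: (Cintegral_bounded_on _ nu0 nufin) => //.
    by apply: CmeasurableB => //; exact: CmeasurableV.
  move=> v; rewrite /= in_itv/= => vI.
  have h1 := Hd _ vI; have h2 := Hw _ vI; have h3 := vm _ vI.
  have c0 : 1 - z0 * v%:C != 0 by rewrite -normc_gt0 (lt_le_trans d0).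
  have w0 : 1 - z * v%:C != 0 by rewrite -normc_gt0 (lt_le_trans _ h2)//
    divr_gt0.
  have hv : 1 - z0 * v%:C - (1 - z * v%:C) = h * v%:C by rewrite /h; ring.
  rewrite (geometric_remainder N c0 w0) hv opprD addrA.
  rewrite (_ : S N v = \sum_(k < N) (h * v%:C) ^+ k / (1 -
    z0 * v%:C) ^+ k.+1); last first.
    by apply: eq_bigr => k _; rewrite /e exprVn exprMn mulrA.
  rewrite subrr add0r normcN normcM normcX normcM !normcV.
  rewrite ler_pM ?exprn_ge0 ?invr_ge0 ?normc_ge0 ?mulr_ge0 ?invr_ge0
    ?normc_ge0//.
    rewrite lerXn2r ?nnegrE ?mulr_ge0 ?invr_ge0 ?normc_ge0//.
    rewrite ler_pdivrMr ?(lt_le_trans d0)// normcM normc_real.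
    have : normc h * `|v| <= normc h * m by rewrite ler_wpM2l// normc_ge0.
    lra.
  by rewrite lef_pV2 ?posrE ?divr_gt0// (lt_le_trans _ h2)// divr_gt0.
apply/cvg_normcP => eps eps0.
have : (fun N => 2 * (2^-1 ^+ N / (d / 2)) * fine (nu setT)) @ \oo --> (0 : R).
  rewrite (_ : (fun _ => _) =
    geometric (2 / (d / 2) * fine (nu setT)) 2^-1).
    by apply: cvg_geometric; rewrite gtr0_norm// invf_lt1 ?ltr1n.
  by apply/funext => N /=; ring.
move=> /cvgrPdist_lt/(_ _ eps0)[N _ HN]; exists N => n Nn.
rewrite (le_lt_trans (rem n))// (le_lt_trans _ (HN n Nn))//.
by rewrite sub0r normrN ler_norm.
Qed.

End kernel_integral.

(** * Integration against the measure of density the cube of |v| *)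

Section density.
Local Open Scope ereal_scope.
Context d (T : measurableType d) {R : realType}.
Variables (m nu : {measure set T -> \bar R}) (g : T -> R).
Hypotheses (mg : measurable_fun setT g) (g0 : forall x, (0 <= g x)%R)
  (nuE : forall A, measurable A -> nu A = \int[m]_(x in A) (g x)%:E).
Import HBNNSimple.

(** The definition of nu gives the equality on indicators; it passes to simple
    functions by linearity and to f by monotone convergence. *)
Lemma ge0_integral_density (f : T -> \bar R) : measurable_fun setT f ->
  (forall x, 0 <= f x) -> \int[nu]_x f x = \int[m]_x (f x * (g x)%:E).
Proof.
move=> mf f0; pose h := nnsfun_approx measurableT mf.
have mgE : measurable_fun setT (EFin \o g) by exact/measurable_EFinP.
have fE x : setT x -> f x = limn (fun n => (h n x)%:E).
  by move=> _; apply/esym/cvg_lim => //; exact: cvg_nnsfun_approx.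
have -> : \int[nu]_x f x = limn (fun n => \int[nu]_x (h n x)%:E).
  under eq_integral => x /[!inE] /fE -> //.
  apply: monotone_convergence => //.
  - by move=> n; apply/measurable_EFinP; exact/measurable_funP.
  - by move=> n x _ /=; rewrite lee_fin.
  - by move=> x _ a b ab; rewrite lee_fin; exact/lefP/nd_nnsfun_approx.
have -> : \int[m]_x (f x * (g x)%:E) =
  limn (fun n => \int[m]_x ((h n x)%:E * (g x)%:E)).
  have fgE x : setT x -> f x * (g x)%:E = limn (fun n => (h n x)%:E * (g x)%:E).
    move=> _; apply/esym/cvg_lim => //; apply: cvgeZr => //.
    exact: cvg_nnsfun_approx.
  under eq_integral => x /[!inE] /fgE -> //.
  apply: monotone_convergence => //.
  - move=> n; apply/emeasurable_funM => //.
    by apply/measurable_EFinP; exact/measurable_funP.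
  - by move=> n x _ /=; rewrite mule_ge0// lee_fin.
  - move=> x _ a b ab/=; rewrite lee_wpmul2r ?lee_fin//.
    exact/lefP/nd_nnsfun_approx.
congr (limn _); apply/funext => n.
rewrite integralT_nnsfun sintegralE.
transitivity (\int[m]_x (\sum_(y \in range (h n))
    (y * \1_(h n @^-1` [set y]) x)%:E * (g x)%:E)); last first.
  apply: eq_integral => x _.
  rewrite -ge0_mule_fsuml => [|y]; last exact: nnfun_muleindic_ge0.
  by rewrite fsumEFin // -(fimfunE _ x).
rewrite ge0_integral_fsum//; last 2 first.
  - move=> y; apply: emeasurable_funM => //.
    by apply/measurable_EFinP; exact: measurable_funM.
  - by move=> y x _; apply: mule_ge0;
      [exact: nnfun_muleindic_ge0|rewrite lee_fin].
apply: eq_fsbigr => r rhn.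
under [RHS]eq_integral do rewrite EFinM -muleA.
have [r0|r0] := leP 0%R r; last first.
  have -> : h n @^-1` [set r] = set0.
    apply/seteqP; split => // x /= hx.
    by have : (0 <= h n x)%R by []; rewrite hx leNgt r0.
  by rewrite measure0 mule0 (eq_integral (cst 0)) ?integral0// => x _;
    rewrite indicE in_set0 mul0e mule0.
rewrite ge0_integralZl//; last 2 first.
  - apply: emeasurable_funM => //; first exact/measurable_EFinP.
  - by move=> x _; rewrite mule_ge0// lee_fin.
congr (_ * _); rewrite nuE//.
rewrite [LHS]integral_mkcond; apply: eq_integral => x _.
by rewrite epatch_indic muleC.
Qed.

End density.

Section cubic_measure.
Context {R : realType}.
Variable mu : {measure set R -> \bar R}.

Lemma ge0_integral_cubic_mu_star (f : R -> \bar R) : measurable_fun setT f ->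
  (forall x, 0 <= f x)%E ->
  (\int[cubic_mu_star mu]_v f v =
    \int[mu]_u (f (u^-1)%R * (`|u^-1|%R ^+ 3)%:E))%E.
Proof.
move=> mf f0; have mW : measurable_fun setT (fun v : R => `|v| ^+ 3).
  by apply: measurable_funX; exact: normr_measurable.
rewrite (@ge0_integral_density _ _ _ (mu_star mu) (cubic_mu_star mu) _ mW)//.
rewrite (@ge0_integral_pushforward _ _ _ _ _ _ (@measurable_inv_real R))//.
  by apply: emeasurable_funM => //; exact/measurable_EFinP.
by move=> v _; rewrite mule_ge0// lee_fin exprn_ge0.
Qed.

(** The weight being nonnegative, the positive and the negative part of f can be
    treated separately. *)
Lemma integral_cubic_mu_star (f : R -> R) : measurable_fun setT f ->
  (\int[cubic_mu_star mu]_v (f v)%:E =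
   \int[mu]_u (f u^-1 * `|u^-1| ^+ 3)%:E)%E.
Proof.
move=> mf; have mfE : measurable_fun setT (EFin \o f) by exact/measurable_EFinP.
rewrite integralE [in RHS]integralE; congr (_ - _)%E.
- rewrite ge0_integral_cubic_mu_star//; last exact: measurable_funepos.
  apply: eq_integral => u _; rewrite !funeposE/= EFinM.
  by rewrite maxe_pMl ?mul0e// lee_fin exprn_ge0.
- rewrite ge0_integral_cubic_mu_star//; last exact: measurable_funeneg.
  apply: eq_integral => u _; rewrite !funenegE/= -mulNr EFinM.
  by rewrite maxe_pMl ?mul0e// lee_fin exprn_ge0.
Qed.

End cubic_measure.

(** * Location of the mixing measure, and the cut plane *)

Section support.
Context {R : realType}.
Variable mu : {measure set R -> \bar R}.

(** On S the integrand is at least exp(- c y / 2), so mu S is at most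
    C exp(- c y / 2) for all large y.  The absolute value serves both half-lines
    at once. *)
Lemma exp_decay_null (D S : set R) (C c M : R) : measurable D -> measurable S ->
  S `<=` D -> 0 < c -> (forall u, S u -> `|u| < c / 2) ->
  (forall y : R, M <= y ->
     (\int[mu]_(u in D) (expR (- (`|u| * y)))%:E <=
       (C * expR (- (c * y)))%:E)%E) ->
  mu S = 0%E.
Proof.
move=> mD mS SD c0 Sc H.
have mE (y : R) : measurable_fun setT (fun u : R => (expR (- (`|u| * y)))%:E).
  apply/measurable_EFinP; apply: measurableT_comp => //.
  by apply: measurableT_comp => //; apply: measurable_funM.
have key (y : R) : M <= y -> 0 <= y ->
  (mu S <= (C * expR (- (c / 2 * y)))%:E)%E.
  move=> My y0.
  have : (\int[mu]_(u in S) (expR (- (c / 2 * y)))%:E <=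
    (C * expR (- (c * y)))%:E)%E.
    apply: le_trans (H _ My); apply: (@le_trans _ _
      (\int[mu]_(u in S) (expR (- (`|u| * y)))%:E)%E); last first.
      by apply: ge0_subset_integral => //; exact: measurable_funTS.
    apply: ge0_le_integral => //; first exact: measurable_funTS.
    move=> u Su; rewrite lee_fin ler_expR lerN2 ler_wpM2r//; exact/ltW/Sc.
  rewrite integral_cst// -lee_pdivlMl ?expR_gt0// -EFinM => /le_trans; apply.
  by rewrite lee_fin -expRN opprK mulrCA -expRD le_eqVlt; apply/orP; left;
    apply/eqP; congr (_ * expR _); field.
apply/eqP; rewrite eq_le measure_ge0 andbT; apply/lee_addgt0Pr => e e0.
rewrite add0e; pose y := Num.max (Num.max M 0) (`|C| / e / (c / 2)).
have y0 : 0 <= y by rewrite /y !le_max lexx orbT.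
have My : M <= y by rewrite /y !le_max lexx.
apply: (le_trans (key _ My y0)); rewrite lee_fin.
apply: (@le_trans _ _ (`|C| * expR (- (c / 2 * y)))).
  by rewrite ler_wpM2r ?expR_ge0// ler_norm.
rewrite expRN ler_pdivrMr ?expR_gt0// -ler_pdivrMl// mulrC.
apply: le_trans (expR_ge1Dx _).
have : `|C| / e / (c / 2) <= y by rewrite /y le_max lexx orbT.
rewrite ler_pdivrMr ?divr_gt0// mulrC => ?.
by rewrite ler_wpDl// [leRHS]mulrC.
Qed.

Variables (dens : R -> R) (rhoh rho : \bar R).
Hypothesis cm : CM_class rhoh rho dens mu.

Lemma rho_gt0 : (0 < rho)%E.
Proof.
have [[C [c [M [c0 dexp]]]] _ _ _ [pos _] -> _] := cm.
suff m0 : mu `]0, (c / 2)[%classic = 0%E.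
  apply: (@lt_le_trans _ _ (c / 2)%:E); first by rewrite lte_fin divr_gt0.
  by apply: ereal_sup_ubound; exists (c / 2) => //; split => //;
    rewrite divr_ge0// ltW.
apply: (@exp_decay_null `]0, +oo[%classic _ C c (Num.max M 1)) => //.
- by move=> u /=; rewrite !in_itv/= => /andP[->].
- by move=> u /=; rewrite in_itv/= => /andP[u0 ?]; rewrite gtr0_norm.
move=> y; rewrite ge_max => /andP[My y1].
have y0 : 0 < y by apply: lt_le_trans y1.
have := dexp y; rewrite gtr0_norm// => /(_ My); rewrite -lee_fin.
apply: le_trans; rewrite pos// le_eqVlt; apply/orP; left; apply/eqP.
apply: eq_integral => u; rewrite inE/= in_itv/= andbT => u0.
by rewrite gtr0_norm.
Qed.

Lemma rhoh_gt0 : (0 < rhoh)%E.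
Proof.
have [[C [c [M [c0 dexp]]]] _ _ _ [_ neg] _ ->] := cm.
suff m0 : mu `](- (c / 2)), 0[%classic = 0%E.
  apply: (@lt_le_trans _ _ (c / 2)%:E); first by rewrite lte_fin divr_gt0.
  by apply: ereal_sup_ubound; exists (c / 2) => //; split => //;
    rewrite divr_ge0// ltW.
apply: (@exp_decay_null `]-oo, 0[%classic _ C c (Num.max M 1)) => //.
- by move=> u /=; rewrite !in_itv/= => /andP[_ ->].
- by move=> u /=; rewrite in_itv/= => /andP[? u0]; rewrite ltr0_norm// ltrNl.
move=> y; rewrite ge_max => /andP[My y1].
have y0 : 0 < y by apply: lt_le_trans y1.
have := dexp (- y); rewrite normrN gtr0_norm// => /(_ My); rewrite -lee_fin.
apply: le_trans; rewrite neg ?oppr_lt0// le_eqVlt; apply/orP; left; apply/eqP.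
apply: eq_integral => u; rewrite inE/= in_itv/= => u0.
by rewrite ltr0_norm// mulNr mulrN.
Qed.

Lemma measurable_between0 (r : \bar R) :
  measurable [set u : R | 0 < u /\ (u%:E < r)%E].
Proof.
case: r => [r| |].
- rewrite (_ : [set _ | _] = `]0, r[%classic)//.
  apply/seteqP; split => u /=; rewrite in_itv/= lte_fin; first by case=> -> ->.
  by move=> /andP[].
- rewrite (_ : [set _ | _] = `]0, +oo[%classic)//.
  apply/seteqP; split => u /=; rewrite in_itv/= andbT ltry; first by case.
  by [].
- rewrite (_ : [set _ | _] = set0)//.
  by apply/seteqP; split => u //= [_]; rewrite ltNge leNye.
Qed.

Lemma measurable_between0N (r : \bar R) :
  measurable [set u : R | u < 0 /\ ((- u)%:E < r)%E].
Proof.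
have -> : [set u : R | u < 0 /\ ((- u)%:E < r)%E] =
    -%R @^-1` [set u : R | 0 < u /\ (u%:E < r)%E].
  by apply/seteqP; split => u /=; rewrite oppr_gt0.
by rewrite -[X in measurable X]setTI; apply: oppr_measurable => //;
  exact: measurable_between0.
Qed.

(** The intervals (0, u) with u < rho are null, but there are uncountably many
    of them; those with a rational end point already cover (0, rho). *)
Lemma null_rat_cover (S : rat -> set R) (B : set R) :
  (forall q, measurable (S q)) -> measurable B ->
  (forall u, B u -> exists2 q, mu (S q) = 0%E & S q u) -> mu B = 0%E.
Proof.
move=> mS mB H.
pose F (n : nat) : set R := if unpickle n is Some q then
  if mu (S q) == 0%E then S q else set0 else set0.
apply/negligibleP => //.
apply: (@negligibleS _ _ _ _ (\bigcup_n F n)); last first.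
  apply: negligible_bigcup => n; rewrite /F; case: unpickle => [q|].
    case: eqP => // h; last exact: negligible_set0.
    by apply/negligibleP.
  exact: negligible_set0.
move=> u /H[q q0 Sqx]; exists (pickle q); first exact: I.
by rewrite /F pickleK (introT eqP q0).
Qed.

Lemma mu_below_rho : mu [set u : R | 0 < u /\ (u%:E < rho)%E] = 0%E.
Proof.
apply: (@null_rat_cover (fun q => `]0, ratr q[%classic)) => //.
  exact: measurable_between0.
move=> u /= [u0]; have [_ _ _ _ _ -> _] := cm.
move=> /ereal_sup_gt[_ [s [s0 ms] <-]]; rewrite lte_fin => us.
have [q] := rat_in_itvoo us; rewrite in_itv/= => /andP[uq qs].
exists q; last by rewrite in_itv/= u0.
apply/eqP; rewrite eq_le measure_ge0 andbT -ms le_measure ?inE//.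
by move=> v /=; rewrite !in_itv/= => /andP[->/= /lt_trans]; apply.
Qed.

Lemma mu_below_rhoh : mu [set u : R | u < 0 /\ ((- u)%:E < rhoh)%E] = 0%E.
Proof.
apply: (@null_rat_cover (fun q => `](- ratr q), 0[%classic)) => //.
  exact: measurable_between0N.
move=> u /= [u0]; have [_ _ _ _ _ _ ->] := cm.
move=> /ereal_sup_gt[_ [s [s0 ms] <-]]; rewrite lte_fin => us.
have [q] := rat_in_itvoo us; rewrite in_itv/= => /andP[uq qs].
exists q; last by rewrite in_itv/= u0 ltrNl uq.
apply/eqP; rewrite eq_le measure_ge0 andbT -ms le_measure ?inE//.
move=> v /=; rewrite !in_itv/= => /andP[qv ->]; rewrite andbT.
by rewrite (lt_trans _ qv)// ltrN2.
Qed.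

End support.

Section interval.
Context {R : realType}.
Variables rhoh rho : \bar R.
Hypotheses (rhoh0 : (0 < rhoh)%E) (rho0 : (0 < rho)%E).

Lemma inve_fine (r : \bar R) : (0 < r)%E -> (r^-1)%E = (fine r^-1)%:E.
Proof.
case: (inveP r) => [|//|//|//]; by rewrite ltxx.
Qed.

Let al := - fine rhoh^-1.
Let be := fine rho^-1.

Lemma quadrature_intervalE : quadrature_interval rhoh rho = `[al, be]%classic.
Proof.
apply/seteqP; split => v; rewrite /quadrature_interval/= in_itv/= /al /be.
  by rewrite (inve_fine rhoh0) (inve_fine rho0) -EFinN !lee_fin => -[-> ->].
by rewrite (inve_fine rhoh0) (inve_fine rho0) -EFinN !lee_fin => /andP[].
Qed.

Lemma al_le0 : al <= 0.
Proof. by rewrite oppr_le0 fine_ge0// inve_ge0 ltW. Qed.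

Lemma be_ge0 : 0 <= be.
Proof. by rewrite fine_ge0// inve_ge0 ltW. Qed.

Lemma le_inv_rho (u : R) : 0 < u -> (rho <= u%:E)%E = (u^-1 <= be).
Proof.
move=> u0; rewrite -lee_fin /be -(inve_fine rho0); move: rho0.
case: (inveP rho) => [|_|//|r r0]; first by rewrite ltxx.
  by rewrite leye_eq/=; apply/esym/negbTE; rewrite lee_fin -ltNge invr_gt0.
by rewrite lte_fin => r0'; rewrite !lee_fin lef_pV2.
Qed.

Lemma le_inv_rhoh (u : R) : u < 0 -> (rhoh <= (- u)%:E)%E = (al <= u^-1).
Proof.
move=> u0; rewrite /al lerNl -invrN -lee_fin -(inve_fine rhoh0).
have : 0 < - u by rewrite oppr_gt0.
move: (- u) rhoh0 => {u0}u; case: (inveP rhoh) => [|_|//|r r0];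
  first by rewrite ltxx.
  by move=> u0; rewrite leye_eq/=; apply/esym/negbTE;
    rewrite lee_fin -ltNge invr_gt0.
by rewrite lte_fin => r0' u0; rewrite !lee_fin lef_pV2.
Qed.

(** If 1 = z v then z = 1/v is real, and v in [al, be] puts it on one of the two
    cuts. *)
Lemma cut_plane_ne0 (z : Cplx R) : cut_plane rhoh rho z ->
  forall v : R, al <= v <= be -> 1 - z * v%:C != 0.
Proof.
move=> Hz v /andP[av vb]; rewrite subr_eq0; apply/eqP => zv.
have v0 : v != 0.
  apply/eqP => v0; move: zv; rewrite v0 mulr0 => /eqP.
  by rewrite oner_eq0.
have zE : z = (v^-1)%:C.
  have vC : v%:C != 0 :> Cplx R by rewrite -[0]/(0%:C) (inj_eq (@complexI _)).
  by apply: (mulIf vC); rewrite -zv -rmorphM/= mulVf.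
apply: Hz; rewrite zE/=; split => //.
have [v1|v1|v1] := ltgtP v 0; last by rewrite v1 eqxx in v0.
  left; rewrite -leeN2 oppeK -EFinN le_inv_rhoh ?invr_lt0// invrK//.
by right; rewrite le_inv_rho ?invr_gt0// invrK.
Qed.

Variable mu : {measure set R -> \bar R}.
Hypotheses (mu0 : mu [set 0] = 0%E)
  (mup : mu [set u : R | 0 < u /\ (u%:E < rho)%E] = 0%E)
  (mun : mu [set u : R | u < 0 /\ ((- u)%:E < rhoh)%E] = 0%E).

Lemma cubic_mu_star_outside : cubic_mu_star mu (~` `[al, be]) = 0%E.
Proof.
have mC : measurable (~` `[al, be]%classic : set R) by exact: measurableC.
suff H : mu_star mu (~` `[al, be]) = 0%E.
  rewrite /cubic_mu_star; have := @integral_abs_eq0 _ _ _ (mu_star mu) _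
    (fun v => (`|v| ^+ 3)%:E) mC _ H.
  rewrite -[X in _ -> X]/(_ = _) => <-.
    by apply: eq_integral => v _; rewrite gee0_abs// lee_fin exprn_ge0.
  apply/measurable_EFinP; apply: measurable_funX; exact: normr_measurable.
rewrite /mu_star /pushforward; apply/negligibleP.
  by rewrite -[X in measurable X]setTI; exact: measurable_inv_real.
apply: (@negligibleS _ _ _ _ ([set 0] `|` ([set u : R | 0 < u /\ (u%:E < rho)%E]
  `|` [set u : R | u < 0 /\ ((- u)%:E < rhoh)%E]))); last first.
  apply: negligibleU; first exact/negligibleP.
  apply: negligibleU; apply/negligibleP => //.
    exact: measurable_between0.
  exact: measurable_between0N.
move=> u /=; rewrite in_itv/= => /negP; rewrite negb_and -!ltNge => uI.
have [u0|u0|->] := ltgtP u 0; [right; right|right; left|by left].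
  split => //; rewrite ltNge; apply/negP;
    rewrite le_inv_rhoh// leNgt => /negP; apply.
  case/orP: uI => // /(le_lt_trans be_ge0); rewrite invr_gt0 => /(lt_trans u0).
  by rewrite ltxx.
split => //; rewrite ltNge; apply/negP; rewrite le_inv_rho// leNgt => /negP;
  apply.
case/orP: uI => // /lt_le_trans/(_ al_le0); rewrite invr_lt0 => /(lt_trans u0).
by rewrite ltxx.
Qed.

End interval.

(** * The Laplace transforms of 1 - cos (t x) and of t x - sin (t x) *)

Section laplace.
Context {R : realType}.

Lemma sin_le_id (y : R) : 0 <= y -> sin y <= y.
Proof.
rewrite le_eqVlt => /predU1P[<-|y0]; first by rewrite sin0.
have cs : {within `[0, y], continuous (@sin R)}.
  by apply/continuous_subspaceT => x; exact: continuous_sin.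
have [c _] := @MVT_segment R sin cos 0 y (ltW y0)
  (fun x _ => is_derive_sin x) cs.
rewrite sin0 !subr0 => ->; by rewrite ler_piMl ?cos_le1// ltW.
Qed.

(** exp(u x) >= (u x)^2 / 2 beats linear growth. *)
Lemma cvg_expR_linear (u K : R) (B : R -> R) : 0 < u ->
  (forall x, 0 <= x -> `|B x| <= K * (1 + x)) ->
  expR (- (u * x)) * B x @[x --> +oo] --> (0 : R).
Proof.
move=> u0 HB.
have K0 : 0 <= K.
  by have := HB 0 (lexx _); rewrite addr0 mulr1; apply: le_trans.
apply/cvgrPdist_le => e e0.
near=> x.
have x1 : 1 <= x by near: x; apply: nbhs_pinfty_ge; rewrite num_real.
have xb : 4 * K / (u ^+ 2 * e) <= x.
  by near: x; apply: nbhs_pinfty_ge; rewrite num_real.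
have x0 : 0 < x by apply: lt_le_trans x1.
rewrite sub0r normrN normrM ger0_norm ?expR_ge0// expRN.
rewrite mulrC ler_pdivrMr ?expR_gt0//.
apply: le_trans (HB _ (ltW x0)) _.
have h := @expR_ge1Dxn R (u * x) 1 (mulr_ge0 (ltW u0) (ltW x0)).
apply: (@le_trans _ _ (e * ((u * x) ^+ 2 / 2))); last first.
  rewrite ler_wpM2l ?(ltW e0)//; apply: le_trans h;
    rewrite (_ : 2`!%:R = 2 :> R)//.
  by rewrite lerDr.
rewrite ler_pdivrMr in xb; last by rewrite mulr_gt0// exprn_gt0.
apply: (@le_trans _ _ (2 * K * x)); first by nra.
by rewrite exprMn; nra.
Unshelve. all: by end_near. Qed.

(** If G = B' - u B then exp(- u x) B(x) is a primitive of exp(- u x) G(x), and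
    it vanishes at infinity. *)
Lemma laplace_by_parts (u K : R) (B b G : R -> R) : 0 < u ->
  (forall x : R, is_derive x (1 : R) B (b x)) ->
    (forall x, G x = b x - u * B x) ->
  continuous G -> (forall x, 0 <= x -> 0 <= G x) ->
  (forall x, 0 <= x -> `|B x| <= K * (1 + x)) ->
  (\int[lebesgue_measure]_(x in `[0%R, +oo[) (G x * expR (- (u * x)))%:E)%E =
    (- B 0)%:E.
Proof.
move=> u0 dB GE cG G0 HB.
pose F x := expR (- (u * x)) * B x.
have cM : continuous (fun x : R => expR (- (u * x))).
  move=> x; apply: continuous_comp; last exact: continuous_expR.
  by apply: cvgN; apply: cvgM; [exact: cvg_cst|exact: cvg_id].
have dF (x : R) : is_derive x (1 : R) F (G x * expR (- (u * x))).
  have dB' := dB x.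
  apply: is_derive_eq; rewrite GE /GRing.scale/=; ring.
rewrite (@ge0_continuous_FTC2y _ (fun x => G x * expR (- (u * x))) F 0 0).
- by rewrite /F mulr0 oppr0 expR0 mul1r sub0e.
- by move=> x x0; rewrite mulr_ge0 ?G0 ?expR_ge0.
- by apply: continuous_subspaceT => x; apply: cvgM; [exact: cG|exact: cM].
- exact: (@cvg_expR_linear u K).
- by move=> x _; have [] := dF x.
- apply: cvg_at_right_filter.
  by apply: differentiable_continuous; apply/derivable1_diffP; have [] := dF 0.
- by move=> x _; rewrite derive1E; have [_ ->] := dF x.
Qed.

Lemma laplace_1Bcos (t u : R) : 0 < u ->
  (\int[lebesgue_measure]_(x in `[0%R, +oo[) ((1 -
    cos (t * x)) * expR (- (u * x)))%:E)%E =
  (t ^+ 2 / (u * (u ^+ 2 + t ^+ 2)))%:E.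
Proof.
move=> u0; have s0 : u ^+ 2 + t ^+ 2 != 0.
  by rewrite gt_eqF// ltr_wpDr ?sqr_ge0// exprn_gt0.
pose B x := - u^-1 + (u * cos (t * x) - t * sin (t * x)) / (u ^+ 2 + t ^+ 2).
pose b x := (- (u * t * sin (t * x)) -
  t ^+ 2 * cos (t * x)) / (u ^+ 2 + t ^+ 2).
have dB (x : R) : is_derive x (1 : R) B (b x).
  by apply: is_derive_eq; rewrite /b /GRing.scale/=; field.
rewrite (@laplace_by_parts u (`|u^-1| + (`|u| + `|t|) / `|u ^+ 2 + t ^+ 2|) B b
  (fun x => 1 - cos (t * x)) u0 dB) //.
- rewrite /B mulr0 cos0 sin0; congr EFin.
  by field; rewrite s0 gt_eqF.
- by move=> x; rewrite /B /b; field; rewrite s0 gt_eqF.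
- move=> x; apply: cvgB; first exact: cvg_cst.
  apply: continuous_comp; last exact: continuous_cos.
  by apply: cvgM; [exact: cvg_cst|exact: cvg_id].
move=> x x0; apply: (@le_trans _ _ ((`|u^-1| + (`|u| + `|t|) / `|u ^+ 2 +
  t ^+ 2|))).
  rewrite /B (le_trans (ler_normD _ _))// normrN lerD2l normrM normfV.
  rewrite ler_wpM2r ?invr_ge0// (le_trans (ler_normB _ _))// !normrM lerD//
    ler_piMr//.
    by rewrite ler_norml cos_geN1 cos_le1.
  by rewrite ler_norml sin_geN1 sin_le1.
by rewrite ler_peMr ?lerDl// addr_ge0// divr_ge0// addr_ge0.
Qed.

Lemma laplace_idBsin (t u : R) : 0 < t -> 0 < u ->
  (\int[lebesgue_measure]_(x in `[0%R, +oo[) ((t * x -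
    sin (t * x)) * expR (- (u * x)))%:E)%E =
  (t ^+ 3 / (u ^+ 2 * (u ^+ 2 + t ^+ 2)))%:E.
Proof.
move=> t0 u0; have s0 : u ^+ 2 + t ^+ 2 != 0.
  by rewrite gt_eqF// ltr_wpDr ?sqr_ge0// exprn_gt0.
pose B x := - t * (x / u + (u ^+ 2)^-1) +
  (u * sin (t * x) + t * cos (t * x)) / (u ^+ 2 + t ^+ 2).
pose K := `|t| * (`|u^-1| + `|(u ^+ 2)^-1|) + (`|u| + `|t|) / `|u ^+ 2 +
  t ^+ 2|.
pose b x := - t / u + (u * t * cos (t * x) -
  t ^+ 2 * sin (t * x)) / (u ^+ 2 + t ^+ 2).
have dB (x : R) : is_derive x (1 : R) B (b x).
  by apply: is_derive_eq; rewrite /b /GRing.scale/=; field; rewrite s0 gt_eqF.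
rewrite (@laplace_by_parts u K B b (fun x => t * x - sin (t * x)) u0 dB) //.
- rewrite /B !mulr0 cos0 sin0; congr EFin.
  by field; rewrite s0 gt_eqF.
- by move=> x; rewrite /B /b; field; rewrite s0 gt_eqF.
- have ct : continuous (fun x : R => t * x).
    by move=> x; apply: cvgM; [exact: cvg_cst|exact: cvg_id].
  move=> x; apply: cvgB; first exact: ct.
  by apply: continuous_comp; [exact: ct|exact: continuous_sin].
- by move=> x x0; rewrite /= subr_ge0 sin_le_id// mulr_ge0// ltW.
move=> x x0; have x1 : 1 <= 1 + x by rewrite lerDl.
have xx : `|x| <= 1 + x by rewrite ger0_norm// lerDr.
rewrite /B /K [leRHS]mulrDl (le_trans (ler_normD _ _))// lerD//.
  rewrite normrM normrN -mulrA ler_wpM2l// (le_trans (ler_normD _ _))// mulrDl.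
  rewrite lerD//; first by rewrite normrM mulrC ler_wpM2l.
  by rewrite ler_peMr.
rewrite normrM normfV mulrAC ler_wpM2r ?invr_ge0//.
apply: (@le_trans _ _ (`|u| + `|t|)); last by rewrite ler_peMr// addr_ge0.
rewrite (le_trans (ler_normD _ _))// !normrM lerD// ler_piMr//.
  by rewrite ler_norml sin_geN1 sin_le1.
by rewrite ler_norml cos_geN1 cos_le1.
Qed.

End laplace.

(** * Mixtures of exponentials *)

Section mixture.
Context {R : realType}.

(** Both halves of the density in one kernel: for x <> 0 the density at x is the
    integral of [exp_kernel x] against the mixing measure.  It vanishes when x
    and u have opposite signs, and it is symmetric. *)
Definition exp_kernel (x u : R) : R :=
  if 0 < x * u then expR (- (u * x)) else 0.

Lemma exp_kernel_ge0 x u : 0 <= exp_kernel x u.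
Proof. by rewrite /exp_kernel; case: ifP => // _; exact: expR_ge0. Qed.

Lemma measurable_exp_kernel :
  measurable_fun setT (fun p : R * R => exp_kernel p.1 p.2).
Proof.
apply: measurable_fun_ifT => //.
- by apply: measurable_fun_ltr => //; apply: measurable_funM.
- apply: measurableT_comp => //; apply: measurableT_comp => //.
  by apply: measurable_funM.
Qed.

Lemma exp_kernelP (x : R) : 0 < x ->
  exp_kernel x = (fun u => expR (- (u * x))) \_ `]0, +oo[%classic.
Proof.
move=> x0; apply/funext => u; rewrite patchE /exp_kernel pmulr_rgt0//.
by case: ifPn => u0; [rewrite ifT// inE/= in_itv/= u0|rewrite ifF//;
  apply/negbTE; rewrite notin_setE/= in_itv/= andbT; exact/negP].
Qed.

Lemma exp_kernelN (x : R) : x < 0 ->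
  exp_kernel x = (fun u => expR (- (u * x))) \_ `]-oo, 0[%classic.
Proof.
move=> x0; apply/funext => u; rewrite patchE /exp_kernel nmulr_rgt0//.
by case: ifPn => u0; [rewrite ifT// inE/= in_itv/= u0|rewrite ifF//;
  apply/negbTE; rewrite notin_setE/= in_itv/=; exact/negP].
Qed.

Lemma exp_kernel_sym (x u : R) : exp_kernel x u = exp_kernel u x.
Proof. by rewrite /exp_kernel mulrC (mulrC u). Qed.

Lemma integral_exp_kernel (mu : {measure set R -> \bar R})
    (dens : R -> R) (x : R) :
  represents mu dens -> x != 0 ->
  (\int[mu]_u (exp_kernel x u)%:E)%E = (dens x)%:E.
Proof.
move=> [dp dn]; rewrite neq_lt => /orP[x0|x0].
  rewrite dn// [RHS]integral_mkcond; apply: eq_integral => u _.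
  by rewrite exp_kernelN// restrict_EFin.
rewrite dp// [RHS]integral_mkcond; apply: eq_integral => u _.
by rewrite exp_kernelP// restrict_EFin.
Qed.

(** For a function that on each half-line is a constant multiple of the same
    nonnegative G of |x|, the inner integral of Fubini is known once the Laplace
    transform L of G is.  Even and odd extensions and their absolute values are
    obtained from the choice of the multiples sp and sm. *)
Lemma integral_exp_kernel_half_lines (G L : R -> R) (sp sm : R) :
  continuous G ->
  (forall x, 0 <= x -> 0 <= G x) ->
  (forall u, 0 < u -> (\int[lebesgue_measure]_(x in `[0%R, +oo[)
      (G x * expR (- (u * x)))%:E)%E = (L u)%:E) ->
  forall u, (\int[lebesgue_measure]_x
    ((if 0 < x then sp * G x else sm * G (- x)) * exp_kernel x u)%:E)%E =
    (if 0 < u then sp * L u else if u < 0 then sm * L (- u) else 0)%:E.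
Proof.
move=> cG G0 HL u.
have cGe (v : R) : continuous (fun x : R => G x * expR (- (v * x))).
  move=> x; apply: cvgM; first exact: cG.
  apply: continuous_comp; last exact: continuous_expR.
  by apply: cvgN; apply: cvgM; [exact: cvg_cst|exact: cvg_id].
have mGe (v : R) D : measurable D ->
  measurable_fun D (fun x : R => (G x * expR (- (v * x)))%:E).
  move=> mD; apply/measurable_EFinP; apply: measurable_funTS.
  exact: continuous_measurable_fun.
have iGe (v : R) : 0 < v -> lebesgue_measure.-integrable `[0%R, +oo[
    (fun x : R => (G x * expR (- (v * x)))%:E).
  move=> v0; apply/integrableP; split; first exact: mGe.
  have -> : (\int[lebesgue_measure]_(x in `[0%R, +oo[)
      `|(G x * expR (- (v * x)))%:E| = (L v)%:E)%E; last exact: ltry.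
  rewrite -HL//; apply: eq_integral => x; rewrite inE/= in_itv/= andbT => x0.
  by rewrite /= ger0_norm// mulr_ge0 ?expR_ge0 ?G0.
have [u0|u0|<-] := ltgtP 0 u.
- transitivity (\int[lebesgue_measure]_(x in `]0%R, +oo[)
      (sp%:E * (G x * expR (- (u * x)))%:E))%E.
    rewrite [RHS]integral_mkcond; apply: eq_integral => x _.
    rewrite exp_kernel_sym exp_kernelP// !patchE mem_setE in_itv/= andbT.
    by case: ifPn => x0; rewrite ?mulr0// (mulrC x) -EFinM mulrA.
  rewrite integral_itv_obnd_cbnd; last by apply: measurable_funeM; apply: mGe.
  by rewrite integralZl ?HL//; exact: iGe.
- transitivity (\int[lebesgue_measure]_(x in `]-oo, 0%R[)
      (sm%:E * (G (- x) * expR (- (u * x)))%:E))%E.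
    rewrite [RHS]integral_mkcond; apply: eq_integral => x _.
    rewrite exp_kernel_sym exp_kernelN// !patchE mem_setE in_itv/=.
    have [x0|x0] := ltP x 0; last by rewrite mulr0.
    by rewrite lt_gtF//= (mulrC x) -EFinM mulrA.
  pose H x := G (- x) * expR (- (u * x)).
  have cH : continuous H.
    have -> : H = (fun x => G x * expR (- (- u * x))) \o -%R.
      by apply/funext => x; rewrite /H/= mulrNN.
    by move=> x; apply: continuous_comp; [exact: oppr_continuous|exact: cGe].
  have mH D : measurable D -> measurable_fun D (fun x : R => (H x)%:E).
    move=> mD; apply/measurable_EFinP; apply: measurable_funTS.
    exact: continuous_measurable_fun.
  have HE : (\int[lebesgue_measure]_(x in `]-oo, 0%R]) (H x)%:E =
    (L (- u))%:E)%E.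
    rewrite -[X in `]-oo, X]%classic]oppr0 ge0_integration_by_substitutionNy.
    - rewrite -HL ?oppr_gt0//; apply: eq_integral => x _.
      by rewrite /H/= opprK mulrN mulNr.
    - exact: continuous_subspaceT.
    - move=> x; rewrite oppr0 in_itv/= => x0.
      by rewrite mulr_ge0 ?expR_ge0// G0// oppr_ge0 ltW.
  rewrite integral_itv_bndo_bndc; last by apply: measurable_funeM; apply: mH.
  rewrite integralZl// ?HE//; apply/integrableP; split; first exact: mH.
  have -> : (\int[lebesgue_measure]_(x in `]-oo, 0%R])
      `|(H x)%:E| = (L (- u))%:E)%E; last exact: ltry.
  rewrite -HE; apply: eq_integral => x; rewrite inE/= in_itv/= => x0.
  by rewrite /= ger0_norm// mulr_ge0 ?expR_ge0 ?G0// oppr_ge0.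
- rewrite (eq_integral (cst 0%E)) ?integral0// => x _.
  by rewrite /exp_kernel mulr0 ltxx mulr0.
Qed.

End mixture.

Section fubini_mixture.
Context {R : realType}.

(** The line is the null set {0} together with the compact sets
    1/(n+1) <= |u| <= n+1. *)
Lemma radon_off0_sigma_finite (mu : {measure set R -> \bar R}) :
  radon_off0 mu -> sigma_finite setT mu.
Proof.
move=> [mu0 muK].
pose K (n : nat) : set R := `[n.+1%:R^-1, n.+1%:R] `|` `[- n.+1%:R, -
  n.+1%:R^-1].
have cK n : compact (K n) by apply: compactU; exact: segment_compact.
have mK n : measurable (K n) by apply: measurableU.
have m0 : measurable ([set 0] : set R) by exact: measurable_set1.
exists (fun n => [set 0] `|` K n).
  apply/esym/seteqP; split => // u _.
  have [->|u0] := eqVneq u 0; first by exists 0%N => //; left.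
  pose n := (Num.truncn (`|u| + `|u|^-1)).
  have un : `|u| + `|u|^-1 <= n.+1%:R by rewrite ltW// truncnS_gt.
  have v0 : 0 < `|u| by rewrite normr_gt0.
  have h1 : `|u| <= n.+1%:R by apply: le_trans un; rewrite lerDl invr_ge0.
  have h2 : n.+1%:R^-1 <= `|u|.
    rewrite -[leRHS]invrK lef_pV2 ?posrE ?invr_gt0//.
    by apply: le_trans un; rewrite lerDr.
  exists n => //; right; have [u1|u1] := leP 0 u.
    by left; rewrite /= in_itv/= -(ger0_norm u1) h1 h2.
  by right; rewrite /= in_itv/= lerNl lerNr -(ltr0_norm u1) h1 h2.
move=> n; split; first exact: measurableU.
rewrite (@le_lt_trans _ _ (mu [set 0%R] + mu (K n))%E)//;
  first exact: measureU2.
rewrite lte_add_pinfty//; first by rewrite mu0 ltry.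
apply: muK => //; rewrite /K => -[|] /=; rewrite in_itv/=.
  by move=> /andP[+ _]; rewrite leNgt invr_gt0 ltr0Sn.
by move=> /andP[_]; rewrite lerNr oppr0 leNgt invr_gt0 ltr0Sn.
Qed.

(** Replace dens by the integral of [exp_kernel] and exchange the integrals; A
    being the inner integral of the absolute values, its integrability is what
    Fubini requires.  The point x = 0, where dens is unconstrained, is harmless
    because g 0 = 0. *)
Lemma mixture_integral (mu : {sigma_finite_measure set R -> \bar R})
    (dens g J A : R -> R) :
  represents mu dens -> measurable_fun setT g -> g 0 = 0 ->
  (forall u, (\int[lebesgue_measure]_x (g x * exp_kernel x u)%:E)%E =
    (J u)%:E) ->
  (forall u, (\int[lebesgue_measure]_x (`|g x| * exp_kernel x u)%:E)%E =
    (A u)%:E) ->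
  (\int[mu]_u (A u)%:E < +oo)%E ->
  (\int[lebesgue_measure]_x (g x * dens x)%:E = \int[mu]_u (J u)%:E)%E.
Proof.
move=> rep mg g0 HJ HA Afin.
pose f (p : R * R) : \bar R := (g p.1 * exp_kernel p.1 p.2)%:E.
have mf : measurable_fun setT f.
  apply/measurable_EFinP; apply: measurable_funM;
    last exact: measurable_exp_kernel.
  exact: measurableT_comp.
have imf : (lebesgue_measure \x mu)%E.-integrable setT f.
  apply/integrable21ltyP; first exact: mf.
  apply: le_lt_trans Afin.
  rewrite le_eqVlt; apply/orP; left; apply/eqP; apply: eq_integral => u _.
  rewrite -HA; apply: eq_integral => x _.
  by rewrite /f/= normrM (ger0_norm (exp_kernel_ge0 _ _)).
have mk x : measurable_fun setT (fun u => (exp_kernel x u)%:E).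
  apply/measurable_EFinP.
  apply: (measurableT_comp measurable_exp_kernel (_ : measurable_fun setT (fun
    u => (x, u)))).
  exact: pair1_measurable.
transitivity (\int[lebesgue_measure]_x \int[mu]_u f (x, u))%E.
  apply: eq_integral => x _.
  have [->|x0] := eqVneq x 0.
    by rewrite g0 mul0r /f/= (eq_integral (cst 0%E)) ?integral0// => u _;
      rewrite g0 mul0r.
  have ik : mu.-integrable setT (fun u => (exp_kernel x u)%:E).
    apply/integrableP; split; first exact: mk.
    have -> : (\int[mu]_u `|(exp_kernel x u)%:E| = (dens x)%:E)%E;
      last exact: ltry.
    rewrite -(integral_exp_kernel rep x0); apply: eq_integral => u _.
    by rewrite /= ger0_norm// exp_kernel_ge0.
  rewrite EFinM -(integral_exp_kernel rep x0) -integralZl//.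
rewrite (Fubini imf); apply: eq_integral => u _.
by rewrite -HJ.
Qed.

End fubini_mixture.

(** * The Laplace exponent on the imaginary axis *)

Section imaginary_axis.
Context {R : realType}.
Variables (mu : {measure set R -> \bar R}) (dens : R -> R) (al be : R).
Hypotheses (mu_radon : radon_off0 mu) (rep : represents mu dens).
Local Notation nu := (cubic_mu_star mu).
Hypotheses (nu0 : nu (~` `[al, be]) = 0%E) (nufin : (nu setT < +oo)%E).

(** When the inner integral has the form phi(1/u) / |u|^3, the substitution
    v = 1/u turns the result into an integral against nu, where boundedness of
    phi suffices for integrability. *)
Lemma mixture_integral_cubic (g phi : R -> R) (B : R) :
  measurable_fun setT g -> g 0 = 0 ->
  measurable_fun setT phi -> (forall v, `|phi v| <= B) ->
  (forall u, (\int[lebesgue_measure]_x (g x * exp_kernel x u)%:E)%E =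
    (phi u^-1 * `|u^-1| ^+ 3)%:E) ->
  (forall u, (\int[lebesgue_measure]_x (`|g x| * exp_kernel x u)%:E)%E =
    (`|phi u^-1| * `|u^-1| ^+ 3)%:E) ->
  \int[lebesgue_measure]_x (g x * dens x) = \int[nu]_v phi v.
Proof.
move=> mg g0 mphi phiB HJ HA; rewrite /Rintegral; congr fine.
have sf := radon_off0_sigma_finite mu_radon.
pose sF := isSFinite.Build _ _ _ _ (sfinite_measure_sigma_finite sf).
pose sS := isSigmaFinite.Build _ _ _ _ sf.
pose muS := HB.pack_for (SigmaFiniteMeasure.type R R) (Measure.sort mu) sF sS.
rewrite (@mixture_integral R muS dens g _ _ rep mg g0 HJ HA).
  by rewrite integral_cubic_mu_star.
rewrite -(integral_cubic_mu_star mu (f := fun v => `|phi v|));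
  last exact: measurableT_comp.
have /integrableP[_] := integrable_bounded_on (measurable_itv _) nu0 nufin
  mphi (fun v _ => phiB v).
exact.
Qed.

Variable t : R.
Hypothesis t0 : 0 < t.

Let den_gt0 (v : R) : 0 < 1 + t ^+ 2 * v ^+ 2.
Proof. by rewrite ltr_pwDl// mulr_ge0// sqr_ge0. Qed.

Let den_norm (v : R) :
  `|(1 + t ^+ 2 * v ^+ 2)^-1| = (1 + t ^+ 2 * v ^+ 2)^-1.
Proof. by rewrite ger0_norm// invr_ge0 ltW. Qed.

Let mden : measurable_fun setT (fun v : R => (1 + t ^+ 2 * v ^+ 2)^-1).
Proof.
apply: (measurableT_comp measurable_inv_real).
by apply: measurable_funD => //; apply: measurable_funM => //;
  apply: measurable_funX.
Qed.

Let ct : continuous (fun x : R => t * x).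
Proof. by move=> x; apply: cvgM; [exact: cvg_cst|exact: cvg_id]. Qed.

(** Up to sign, the inner integral t^2 / (|u| (u^2 + t^2)) is
    t^2 / (1 + t^2 v^2) times |v|^3 at v = 1/u. *)
Lemma integral_cosB1 :
  \int[lebesgue_measure]_x ((cos (t * x) - 1) * dens x) =
  \int[nu]_v (- t ^+ 2 * (1 + t ^+ 2 * v ^+ 2)^-1).
Proof.
pose G (x : R) := 1 - cos (t * x).
have cG : continuous G.
  move=> x; apply: cvgB; first exact: cvg_cst.
  by apply: continuous_comp; [exact: ct|exact: continuous_cos].
have G0 x : 0 <= x -> 0 <= G x by rewrite subr_ge0 cos_le1.
have HG := integral_exp_kernel_half_lines _ _ cG G0 (fun u u0 => laplace_1Bcos
  t u0).
have GN x : G (- x) = G x by rewrite /G mulrN cosN.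
have Lv u : 0 < u -> t ^+ 2 / (u * (u ^+ 2 + t ^+ 2)) =
    t ^+ 2 * (1 + t ^+ 2 * u^-1 ^+ 2)^-1 * u^-1 ^+ 3.
  move=> u0; field; rewrite !gt_eqF// ?addr_gt0 ?exprn_gt0//.
apply: (@mixture_integral_cubic _ _ (t ^+ 2)).
- rewrite (_ : (fun _ => _) = \- G); last by apply/funext => x;
    rewrite /G /= opprB.
  by apply: measurable_funN; exact: continuous_measurable_fun.
- by rewrite mulr0 cos0 subrr.
- exact: measurable_funM.
- move=> v; rewrite normrM normrN (ger0_norm (sqr_ge0 t)) ler_piMr ?sqr_ge0//.
  rewrite ger0_norm ?invr_ge0 ?(ltW (den_gt0 _))// invf_le1//.
  by rewrite lerDl mulr_ge0 ?sqr_ge0.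
- move=> u; apply: (@etrans _ _ _ _ _ (etrans (HG (-1) (-1) u) _)).
    apply: eq_integral => x _.
    by rewrite GN if_same mulN1r /G opprB.
  congr EFin; have [u0|u0|<-] := ltgtP 0 u.
  + by rewrite Lv// gtr0_norm ?invr_gt0// !mulN1r !mulNr.
  + by rewrite Lv ?oppr_gt0// ltr0_norm ?invr_lt0// invrN sqrrN !mulN1r !mulNr.
  + by rewrite invr0 normr0 !expr0n/= !mulr0.
- move=> u; apply: (@etrans _ _ _ _ _ (etrans (HG (1) (1) u) _)).
    apply: eq_integral => x _.
    rewrite GN if_same mul1r /G -normrN opprB ger0_norm// subr_ge0 cos_le1//.
  congr EFin.
  rewrite normrM normrN (ger0_norm (sqr_ge0 t)) den_norm.
  have [u0|u0|<-] := ltgtP 0 u.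
  + by rewrite Lv// gtr0_norm ?invr_gt0// mul1r.
  + by rewrite Lv ?oppr_gt0// ltr0_norm ?invr_lt0// invrN sqrrN mul1r.
  + by rewrite invr0 normr0 !expr0n/= !mulr0.
Qed.

(** The inner integral is odd in u: up to sign, for u > 0 it is
    t^3 / (u^2 (u^2 + t^2)), which is t^3 v / (1 + t^2 v^2) times |v|^3 at
    v = 1/u.  It takes opposite signs on the two half-lines, whence the
    coefficients -1 and 1. *)
Lemma integral_sinBid :
  \int[lebesgue_measure]_x ((sin (t * x) - t * x) * dens x) =
  \int[nu]_v (- t ^+ 3 * v * (1 + t ^+ 2 * v ^+ 2)^-1).
Proof.
pose G (x : R) := t * x - sin (t * x).
have cG : continuous G.
  move=> x; apply: cvgB; first exact: ct.
  by apply: continuous_comp; [exact: ct|exact: continuous_sin].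
have G0 x : 0 <= x -> 0 <= G x.
  by move=> x0; rewrite subr_ge0 sin_le_id// mulr_ge0// ltW.
have HG := integral_exp_kernel_half_lines _ _ cG G0 (fun u u0 =>
  laplace_idBsin t0 u0).
have GN x : G (- x) = - G x by rewrite /G mulrN sinN opprB opprK addrC.
have Lv u : 0 < u -> t ^+ 3 / (u ^+ 2 * (u ^+ 2 + t ^+ 2)) =
    t ^+ 3 * u^-1 * (1 + t ^+ 2 * u^-1 ^+ 2)^-1 * u^-1 ^+ 3.
  move=> u0; field; rewrite !gt_eqF// ?addr_gt0 ?exprn_gt0//.
apply: (@mixture_integral_cubic _ _ (t ^+ 2)).
- rewrite (_ : (fun _ => _) = \- G); last by apply/funext => x;
    rewrite /G /= opprB.
  by apply: measurable_funN; exact: continuous_measurable_fun.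
- by rewrite mulr0 sin0 subrr.
- by apply: measurable_funM => //; apply: measurable_funM.
- move=> v; rewrite normrM [X in _ * X]ger0_norm ?invr_ge0 ?(ltW (den_gt0 _))//.
  rewrite ler_pdivrMr//.
  rewrite normrM normrN (ger0_norm (exprn_ge0 3 (ltW t0))) exprSr -mulrA
    ler_wpM2l ?sqr_ge0//.
  have := sqr_ge0 (t * `|v| - 1); rewrite -(real_normK (num_real v)); nra.
- move=> u; apply: (@etrans _ _ _ _ _ (etrans (HG (-1) (1) u) _)).
    apply: eq_integral => x _.
    by rewrite GN mulN1r mul1r if_same /G opprB.
  congr EFin; have [u0|u0|<-] := ltgtP 0 u.
  + by rewrite Lv// gtr0_norm ?invr_gt0// !mulN1r !mulNr.
  + by rewrite Lv ?oppr_gt0// ltr0_norm ?invr_lt0//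
      invrN sqrrN mul1r mulrN !mulNr.
  + by rewrite invr0 normr0 !expr0n/= !mulr0.
- move=> u; apply: (@etrans _ _ _ _ _ (etrans (HG (1) (1) u) _)).
    apply: eq_integral => x _.
    rewrite !mul1r -normrN opprB -/(G x); congr ((_ * _)%:E).
    case: ltP => x0; first by rewrite ger0_norm// G0// ltW.
    by rewrite -normrN -GN ger0_norm// G0// oppr_ge0.
  congr EFin.
  rewrite 2!normrM normrN (ger0_norm (exprn_ge0 _ (ltW t0))).
  rewrite den_norm.
  have [u0|u0|<-] := ltgtP 0 u.
  + by rewrite Lv// gtr0_norm ?invr_gt0// mul1r.
  + by rewrite Lv ?oppr_gt0// ltr0_norm ?invr_lt0// invrN sqrrN mul1r.
  + by rewrite invr0 normr0 !expr0n/= !mulr0.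
Qed.

(** At z = i t one has z^2 / (1 - z v) = (- t^2 - i t^3 v) / (1 + t^2 v^2). *)
Lemma levy_khintchine_imaginary (a : R) :
  levy_khintchine (fun y => y) a 0 dens (0 +i* t) =
  a%:C * (0 +i* t) + (0 +i* t) ^+ 2 *
    Cintegral nu (fun v => (1 - (0 +i* t) * v%:C)^-1).
Proof.
rewrite /levy_khintchine mul0r [0%:C * _]mul0r add0r; congr (_ + _).
set z : Cplx R := 0 +i* t.
have KE (v : R) : 1 - z * v%:C = 1 +i* (- (t * v)) :> Cplx R.
  by apply/eqP; rewrite eq_complex /z/=; apply/andP; split; apply/eqP; ring.
have zxE (x : R) : z * x%:C = 0 +i* (t * x) :> Cplx R.
  by apply/eqP; rewrite eq_complex /z/=; apply/andP; split; apply/eqP; ring.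
have z2 : z ^+ 2 = (- t ^+ 2) +i* 0 :> Cplx R.
  by apply/eqP; rewrite eq_complex expr2 /z/=; apply/andP; split; apply/eqP;
    ring.
rewrite -CintegralZl; last first.
  apply: (@Cintegrable_bounded_on _ _ _ _ _ (measurable_itv _) nu0 nufin _ 1).
    exact: Cmeasurable_kernel.
  move=> v _; rewrite normcV invf_le1 ?normc_gt0.
    by apply: le_trans (Re_le_normc _); rewrite KE/= normr1.
  by rewrite KE; apply/eqP => /(congr1 (@complex.Re R)) /= /eqP;
    rewrite oner_eq0.
rewrite /Cintegral; congr (_ +i* _).
  transitivity (\int[lebesgue_measure]_x ((cos (t * x) - 1) * dens x)).
    apply: eq_Rintegral => x _; rewrite zxE /cexp/= expR0; ring.
  rewrite integral_cosB1; apply: eq_Rintegral => v _.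
  rewrite KE z2/= (_ : 1 ^+ 2 + (- (t * v)) ^+ 2 = 1 + t ^+ 2 * v ^+ 2);
    last by ring.
  by field; rewrite exprMn gt_eqF.
transitivity (\int[lebesgue_measure]_x ((sin (t * x) - t * x) * dens x)).
  apply: eq_Rintegral => x _; rewrite zxE /cexp/= expR0; ring.
rewrite integral_sinBid; apply: eq_Rintegral => v _.
rewrite KE z2/= (_ : 1 ^+ 2 + (- (t * v)) ^+ 2 = 1 + t ^+ 2 * v ^+ 2);
  last by ring.
by field; rewrite exprMn gt_eqF.
Qed.

End imaginary_axis.

(** * Analytic continuation and convergence *)

(** Shrinking towards 0 keeps a real number off the cuts because these do not
    reach 0. *)
Lemma cut_plane_star (R : realType) (rhoh rho : \bar R) (z : Cplx R) (t : R) :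
  (0 < rhoh)%E -> (0 < rho)%E -> cut_plane rhoh rho z -> 0 <= t <= 1 ->
  cut_plane rhoh rho (t%:C * z).
Proof.
case: z => u v rhoh0 rho0 Hz /andP[t0 t1];
  rewrite /cut_plane/= !mul0r subr0 addr0.
move=> [/eqP]; rewrite mulf_eq0 => /orP[/eqP ->|/eqP v0] H.
  case: H; rewrite mul0r; last by rewrite leNgt rho0.
  by rewrite leeNr oppe0 leNgt rhoh0.
apply: Hz; split => //=; case: H => [H|H]; [left|right].
  have tu : t * u < 0.
    by rewrite -lte_fin (le_lt_trans H)// oppe_lt0.
  have u0 : u <= 0 by rewrite leNgt; apply/negP => /ltW u0; move: tu;
    rewrite ltNge mulr_ge0.
  by apply: le_trans H; rewrite lee_fin -[leLHS]mul1r ler_wnM2r.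
have tu : 0 < t * u by rewrite -lte_fin (lt_le_trans rho0).
have u0 : 0 <= u by rewrite leNgt; apply/negP => /ltW u0; move: tu;
  rewrite ltNge mulr_ge0_le0.
by apply: le_trans H _; rewrite lee_fin ler_piMl.
Qed.

(** Both sides are analytic on the cut plane and agree at i t for t > 0; these
    points accumulate at 0, so the difference vanishes near 0 and then along
    every segment [0, z]. *)
Lemma laplace_exponent_continuation (R : realType) (rhoh rho : \bar R) (a : R)
  (dens : R -> R) (mu : {measure set R -> \bar R}) (psi : Cplx R -> Cplx R) :
  (0 < rhoh)%E -> (0 < rho)%E ->
  radon_off0 mu -> represents mu dens ->
  cubic_mu_star mu (~` `[- fine rhoh^-1, fine rho^-1]) = 0%E ->
  (cubic_mu_star mu setT < +oo)%E ->
  (forall z, complex.Re z = 0 -> psi z =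
    levy_khintchine (fun y => y) a 0 dens z) ->
  analytic_on (cut_plane rhoh rho) psi ->
  forall z, cut_plane rhoh rho z ->
    psi z = a%:C * z + z ^+ 2 * Cintegral (cubic_mu_star mu) (fun v => (1 -
      z * v%:C)^-1).
Proof.
move=> rhoh0 rho0 radon rep nu0 nufin psiLK psiA z Hz.
set F := fun z : Cplx R => a%:C * z + z ^+ 2 *
  Cintegral (cubic_mu_star mu) (fun v => (1 - z * v%:C)^-1).
have ab : - fine rhoh^-1 <= fine rho^-1.
  by apply: le_trans (al_le0 rhoh0) (be_ge0 rho0).
have DA y : cut_plane rhoh rho y -> analytic_at y (fun y => psi y - F y).
  move=> Hy; apply: analytic_atB; first exact: psiA.
  apply: analytic_at_drift_sqr.
  have [|th [d [_ d0 /(_ y erefl)[c _ H]]]] :=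
      @uniform_centre R _ _ [set y] ab (@compact_set1 _ y).
    by move=> _ ->; exact: (cut_plane_ne0 rhoh0 rho0).
  by apply: (kernel_integral_analytic nu0 nufin d0) => v /H[].
apply/eqP; rewrite -subr_eq0; apply/eqP.
apply: (@identity_segment R (fun y => psi y - F y) z) => [t t01|].
  by apply: DA; exact: cut_plane_star.
apply: analytic_at_zeros.
  by apply: DA; rewrite -(mul0r z); apply: cut_plane_star => //;
    rewrite lexx ler01.
move=> r r0; exists (0 +i* (r / 2)); split.
  have r2 : 0 < r / 2 by rewrite divr_gt0.
  have -> : normc (0 +i* (r / 2) - 0 : Cplx R) = r / 2.
    by rewrite subr0 /normc expr0n/= add0r sqrtr_sqr gtr0_norm.
  by rewrite r2/=; lra.
rewrite psiLK// (levy_khintchine_imaginary radon rep nu0 nufin) ?divr_gt0//.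
by rewrite /F subrr.
Qed.

Theorem theorem2 (R : realType) (d : measure_display) (T : measurableType d)
  (P : probability T R) (X : R -> {RV P >-> R})
  (rhoh rho : \bar R) (a : R) (dens : R -> R)
  (mu : {measure set R -> \bar R})
  (psi : Cplx R -> Cplx R)
  (x w : forall n : nat, 'I_n -> R)
  (X_levy : levy_process X)
  (psi_exponent : laplace_exponent X psi)
  (X_triple : characteristic_triple (fun y => y) psi a 0 dens)
  (X_CM : CM_class rhoh rho dens mu)
  (psi_extension : analytic_on (cut_plane rhoh rho) psi)
  (mu_infinite : infinite_set (measure_support mu))
  (xw_gauss : forall n : nat, (1 <= n)%N ->
     gauss_quadrature (cubic_mu_star mu) (quadrature_interval rhoh rho)
       (x n) (w n)) :
  forall A : set (Cplx R), compact A -> A `<=` cut_plane rhoh rho ->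
  exists c1 c2 : R, [/\ 0 < c1, 0 < c2 &
    forall z : Cplx R, A z -> forall n : nat, (1 <= n)%N ->
      `|psi_approx a (x n) (w n) z - psi z| < (c1 * expR (- (c2 * n%:R)))%:C].
Proof.
move=> A cA AU.
have rho0 := rho_gt0 X_CM; have rhoh0 := rhoh_gt0 X_CM.
have radon := CM_radon X_CM; have rep := CM_represents X_CM.
rewrite (quadrature_intervalE rhoh0 rho0) in xw_gauss.
set al := - fine _ in xw_gauss; set be := fine _ in xw_gauss.
have ab : al <= be by apply: le_trans (al_le0 rhoh0) (be_ge0 rho0).
have nu0 : cubic_mu_star mu (~` `[al, be]) = 0%E.
  apply: cubic_mu_star_outside => //; first by case: radon.
  - exact: mu_below_rho X_CM.
  - exact: mu_below_rhoh X_CM.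
have nufin : (cubic_mu_star mu setT < +oo)%E.
  (* The moment of order 0 of the rule with one node is a real number. *)
  have [_ _ _ /(_ 0%N isT)] := xw_gauss 1%N isT.
  under eq_integral do rewrite expr0.
  by rewrite integral_cst// mul1e => ->; rewrite ltry.
have [_ _ psiLK] := X_triple.
have psiE := laplace_exponent_continuation rhoh0 rho0 radon rep nu0 nufin
  psiLK psi_extension.
have ne0 z : A z -> forall v : R, al <= v <= be -> 1 - z * v%:C != 0.
  by move=> /AU; exact: (cut_plane_ne0 rhoh0 rho0).
have [th [dl [/andP[th0 th1] dl0 Hc]]] := uniform_centre ab cA ne0.
have [L L0 HL] := compact_normc_bounded cA.
pose mass := fine (cubic_mu_star mu setT).
have mass0 : 0 <= mass by rewrite fine_ge0.
(* The summand 1 makes the final inequality strict. *)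
exists (L ^+ 2 * (3 * mass / dl) + 1), (- ln th); split.
- by rewrite ltr_wpDl// !mulr_ge0// ?invr_ge0 ltW.
- by rewrite oppr_gt0 ln_lt0// th0.
move=> z Az n n1.
have -> : expR (- (- ln th * n%:R)) = th ^+ n.
  by rewrite mulNr opprK mulrC expRM_natl lnK.
rewrite normrE_normc ltcR psiE; last exact: AU.
rewrite /psi_approx opprD addrACA subrr add0r -mulrBr normcM normcX.
have [c c0 Hcv] := Hc z Az.
have [p pn Hp] := kernel_poly_approx n dl0 (ltW th0) c0 Hcv.
have iK : Cintegrable (cubic_mu_star mu) (fun v : R => (1 -
  z * v%:C)^-1 : Cplx R).
  apply: (@Cintegrable_bounded_on _ _ _ _ _ (measurable_itv `[al, be]) nu0
    nufin _ dl^-1).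
    exact: Cmeasurable_kernel.
  move=> v; rewrite /= in_itv/= => /Hcv[_ h].
  by rewrite normcV lef_pV2 ?posrE// (lt_le_trans dl0).
have := gauss_quadrature_error nu0 nufin n1 (xw_gauss n n1)
  (Cmeasurable_kernel z) iK pn Hp.
rewrite -/mass => err.
apply: (@le_lt_trans _ _ (L ^+ 2 * (3 * mass * (th ^+ n / dl)))).
  rewrite ler_pM ?sqr_ge0 ?normc_ge0//.
  by rewrite lerXn2r ?nnegrE ?normc_ge0 ?(ltW L0)// HL.
rewrite [ltRHS](_ : _ = L ^+ 2 * (3 * mass * (th ^+ n / dl)) + th ^+ n);
  last by ring.
by rewrite ltrDl exprn_gt0.
Qed.
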